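(* Let $U = n^{1+\alpha}$ for a constant $\alpha>0$ and word size $w=\log U$. For any dynamic dictionary (maintaining at most $n$ keys from $[U]$) with redundancy $R \le n$, running it on a random operation sequence from the hard distribution below takes at least $\Omega(\log(n/R))$ expected time (cell-probes) per operation.
   Context: A dynamic dictionary maintains a set of at most $n$ distinct keys from $[U]$ under insertions, deletions and membership queries, in the cell-probe model: memory consists of cells of $w$ bits, each read/write of a cell costs one unit, computation is free. The memory has $\log\binom{U}{n}+R$ bits; $R$ is the redundancy. Hard distribution: initialize an empty dictionary with capacity $n$ over $[U]$; pick $K$, a uniformly random $n$-element subset of $[U]$, and insert its keys one by one; then for $i=1,\dots,n$: let $d_i$ be a uniformly random key of $K$ not yet removed, query $d_i$, delete $d_i$, let $a_i$ be a uniformly random key of $[U]$ neither in $K$ nor in the current dictionary, and insert $a_i$. *)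

(* Defs.v *)
From HB Require Import structures.
From mathcomp Require Import all_boot all_order all_algebra.
From mathcomp Require Import reals exp.
Set Implicit Arguments. Unset Strict Implicit. Unset Printing Implicit Defensive.
Import Order.TTheory GRing.Theory Num.Theory.
Local Open Scope ring_scope.

(* Memory: S cells, each holding a word in 'I_W (W = 2^w, i.e. w bits). *)
Definition mem (S W : nat) := 'I_S -> 'I_W.

Definition upd (S W : nat) (m : mem S W) (i : 'I_S) (v : 'I_W) : mem S W :=
  fun j => if j == i then v else m j.

(* An operation in the cell-probe model: an adaptive (finite) sequence of
   cell reads and writes, computation being free. *)
Inductive prog (S W : nat) (A : Type) : Type :=
  | Ret : A -> prog S W A
  | Rd : 'I_S -> ('I_W -> prog S W A) -> prog S W A
  | Wr : 'I_S -> 'I_W -> prog S W A -> prog S W A.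

Fixpoint run (S W : nat) (A : Type) (p : prog S W A) (m : mem S W)
  : A * mem S W * nat :=
  match p with
  | Ret a => (a, m, 0%N)
  | Rd i k => let: (a, m', c) := run (k (m i)) m in (a, m', c.+1)
  | Wr i v p' => let: (a, m', c) := run p' (upd m i v) in (a, m', c.+1)
  end.

Definition res (S W : nat) (A : Type) (p : prog S W A) (m : mem S W) : A :=
  (run p m).1.1.
Definition post (S W : nat) (A : Type) (p : prog S W A) (m : mem S W) : mem S W :=
  (run p m).1.2.
Definition cost (S W : nat) (A : Type) (p : prog S W A) (m : mem S W) : nat :=
  (run p m).2.

Record dict (U S W : nat) := Dict {
  d_init : mem S W;
  d_ins : 'I_U -> prog S W unit;
  d_del : 'I_U -> prog S W unit;
  d_qry : 'I_U -> prog S W bool }.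

Inductive op (U : nat) := Ins of 'I_U | Del of 'I_U | Qry of 'I_U.

Fixpoint correct_from (U S W n : nat) (D : dict U S W) (m : mem S W)
  (X : {set 'I_U}) (s : seq (op U)) : Prop :=
  match s with
  | [::] => True
  | Ins x :: s' => (x \notin X) && (#|X| < n)%N ->
      correct_from n D (post (d_ins D x) m) (x |: X) s'
  | Del x :: s' => x \in X ->
      correct_from n D (post (d_del D x) m) (X :\ x) s'
  | Qry x :: s' => res (d_qry D x) m = (x \in X) /\
      correct_from n D (post (d_qry D x) m) X s'
  end.

Definition correct_dict (U S W n : nat) (D : dict U S W) : Prop :=
  forall s : seq (op U), correct_from n D (d_init D) set0 s.

Definition avg (R : realType) (T : finType) (A : {set T}) (f : T -> R) : R :=
  (\sum_(x in A) f x) / #|A|%:R.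

(* Phase 2 of the hard distribution, i rounds remaining.  K = the initial
   random set, Rm = keys of K not yet removed, X = current contents.
   Returns the expected total number of probes of the remaining operations. *)
Fixpoint phase2 (R : realType) (U S W : nat) (D : dict U S W) (i : nat)
  (m : mem S W) (K Rm X : {set 'I_U}) : R :=
  match i with
  | 0%N => 0
  | i'.+1 =>
    avg Rm (fun d =>
      let m1 := post (d_qry D d) m in
      let m2 := post (d_del D d) m1 in
      let X1 := X :\ d in
      avg (~: (K :|: X1)) (fun a =>
        let m3 := post (d_ins D a) m2 in
        (cost (d_qry D d) m + cost (d_del D d) m1 + cost (d_ins D a) m2)%:R
        + @phase2 R U S W D i' m3 K (Rm :\ d) (a |: X1)))
  end.

(* Phase 1: insert the keys of a uniformly random n-subset K of [U], in
   uniformly random order (i.e. each next key is uniform among the keys not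
   yet inserted); then run phase 2 for n rounds. *)
Fixpoint phase1 (R : realType) (U S W : nat) (D : dict U S W) (n i : nat)
  (m : mem S W) (X : {set 'I_U}) : R :=
  match i with
  | 0%N => @phase2 R U S W D n m X X X
  | i'.+1 =>
    avg (~: X) (fun x =>
      (cost (d_ins D x) m)%:R + @phase1 R U S W D n i' (post (d_ins D x) m) (x |: X))
  end.

(* Expected total number of cell probes of the whole hard sequence
   (n + 3n = 4n operations), starting from the empty dictionary. *)
Definition hard_expected_cost (R : realType) (U S W n : nat) (D : dict U S W) : R :=
  @phase1 R U S W D n n (d_init D) set0.

Definition log2 (R : realType) (x : R) : R := ln x / ln 2.

Definition redundancy (R : realType) (U S w n : nat) : R :=
  (S * w)%:R - log2 ('C(U, n))%:R.

(* Main.v *)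
Require Import Defs.
From HB Require Import structures.
From mathcomp Require Import all_boot all_order all_algebra.
From mathcomp Require Import reals exp.
From mathcomp Require Import all_fingroup zify ring lra.
Import Defs. (* so that [mem] is the memory type and not the MathComp predicate *)
Set Implicit Arguments. Unset Strict Implicit. Unset Printing Implicit Defensive.

(* A history is a permutation [s] of the keys together with a deletion order.  Consider
   [q * l] consecutive rounds, where [l] is at least the redundancy: the first [l] rounds
   probe a set of cells C, the remaining ones a set C'.  If C and C' are almost
   disjoint while the rounds are cheap, the memory can be compressed.  Indeed permute the
   insertions of the block among its [q] groups of [l].  The set of keys after the block is
   unchanged, and as the redundancy is at most [l] many pairs of orders end in the very same
   memory while their first groups of insertions are nearly disjoint.  For such a pair,
   overwrite the memory obtained after the first [l] rounds of one order by the initial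
   contents of the cells probed by the other.  This hybrid memory still reveals the [l]
   deleted keys at the price of an index below [n] each, and then, by replaying the other
   order, the memory it was made from: where both orders have written, both agree with the
   common final memory.  So S cells describe n + l keys, which is [l * log (U / n)] bits too
   many; this must be paid by the probes, O(1) bits for each of them, and by the cells
   of the intersection, [log U] bits each.  Hence cheap rounds force C and C' to meet in at
   least a constant times [l] cells.  Since the intersections of blocks at the scales
   [l = q ^ j * l0] come from different probes, each of the [log (n / R)] scales contributes
   a constant to the cost of an operation. *)

(** * Cell-probe programs *)

Section CellProbe.
Variables S W : nat.
Implicit Types (m : mem S W).

Fixpoint touched A (p : prog S W A) m : {set 'I_S} :=
  match p with
  | Ret _ => set0
  | Rd i k => i |: touched (k (m i)) m
  | Wr i v p' => i |: touched p' (upd m i v)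
  end.

Lemma card_touched A (p : prog S W A) m : #|touched p m| <= cost p m.
Proof.
elim: p m => [a|i k IH|i v p IH] m /=; first by rewrite cards0.
- rewrite cardsU1; have := IH (m i) m.
  by rewrite /cost /=; case: (run _ _) => [[a m'] c] /=; lia.
- rewrite cardsU1; have := IH (upd m i v).
  by rewrite /cost /=; case: (run _ _) => [[a m'] c] /=; lia.
Qed.

Lemma post_untouched A (p : prog S W A) m c :
  c \notin touched p m -> post p m c = m c.
Proof.
elim: p m => [a|i k IH|i v p IH] m //=; rewrite !inE negb_or => /andP[ci].
- move/IH; rewrite /post /=; by case: (run _ _) => [[a m'] n].
- move/IH; rewrite /post /=; case: (run _ _) => [[a m'] n] /= ->.
  by rewrite /upd (negbTE ci).
Qed.

(** Each probe is determined by the values read before it, so memories agreeing on all probed cells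
    drive the program through the same probes. *)
Lemma run_agree A (p : prog S W A) m m' (B : {set 'I_S}) :
  {in B, m =1 m'} -> touched p m \subset B ->
  [/\ res p m' = res p m, touched p m' = touched p m
    & {in B, post p m =1 post p m'}].
Proof.
elim: p m m' => [a|i k IH|i v p IH] m m' mm' //=; rewrite subUset sub1set => /andP[iB].
- move/(IH (m i) _ _ mm'); rewrite /res /post /= -(mm' i iB).
  by case: (run _ m) => [[? ?] ?]; case: (run _ m') => [[? ?] ?] /= [-> -> h].
- have mm'u : {in B, upd m i v =1 upd m' i v}.
    by move=> c cB; rewrite /upd mm'.
  move/(IH _ _ mm'u); rewrite /res /post /=.
  by case: (run p (upd m i v)) => [[? ?] ?]; case: (run _ _) => [[? ?] ?] /= [-> -> h].
Qed.

Fixpoint andthen A B (p : prog S W A) (q : prog S W B) : prog S W B :=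
  match p with
  | Ret _ => q
  | Rd i k => Rd i (fun v => andthen (k v) q)
  | Wr i v p' => Wr i v (andthen p' q)
  end.

Lemma post_andthen A B (p : prog S W A) (q : prog S W B) m :
  post (andthen p q) m = post q (post p m).
Proof.
elim: p m => [a|i k IH|i v p IH] m //=; move: IH; rewrite /post /=.
- move/(_ (m i) m); case: (run _ _) => [[? ?] ?] /= ->.
  by case: (run (k _) _) => [[? ?] ?].
- move/(_ (upd m i v)); case: (run _ _) => [[? ?] ?] /= ->.
  by case: (run p _) => [[? ?] ?].
Qed.

Lemma cost_andthen A B (p : prog S W A) (q : prog S W B) m :
  cost (andthen p q) m = cost p m + cost q (post p m).
Proof.
elim: p m => [a|i k IH|i v p IH] m //=; move: IH; rewrite /post /cost /=.
- move/(_ (m i) m); case: (run _ _) => [[? ?] ?] /= ->.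
  by case: (run (k _) _) => [[? ?] ?].
- move/(_ (upd m i v)); case: (run _ _) => [[? ?] ?] /= ->.
  by case: (run p _) => [[? ?] ?].
Qed.

Lemma touched_andthen A B (p : prog S W A) (q : prog S W B) m :
  touched (andthen p q) m = touched p m :|: touched q (post p m).
Proof.
elim: p m => [a|i k IH|i v p IH] m //=; first by rewrite set0U.
- rewrite IH setUA /post /=.
  by case: (run _ _) => [[? ?] ?].
- rewrite IH setUA /post /=.
  by case: (run _ _) => [[? ?] ?].
Qed.

Lemma post_cost0 A (p : prog S W A) m : cost p m = 0 -> post p m = m.
Proof.
case: p => [a|i k|i v p] //; rewrite /cost /=; by case: (run _ _) => [[? ?] ?].
Qed.

End CellProbe.

(** * Legal memories, and rounds as single programs *)

Section Dictionary.
Variables (U S W n : nat) (D : dict U S W).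
Implicit Types (m : mem S W) (X : {set 'I_U}) (x d a : 'I_U).

(** The invariant quantifies over all continuations rather than past answers, so every admissible
    operation preserves it and the memory alone determines [X]. *)
Definition legit m X := forall s, correct_from n D m X s.

Lemma legit_ins m X x :
  legit m X -> x \notin X -> #|X| < n -> legit (post (d_ins D x) m) (x |: X).
Proof. by move=> mX xX cX s; apply: (mX (Ins x :: s)); rewrite xX. Qed.

Lemma legit_del m X x : legit m X -> x \in X -> legit (post (d_del D x) m) (X :\ x).
Proof. by move=> mX xX s; apply: (mX (Del x :: s)). Qed.

Lemma legit_qry m X x : legit m X -> legit (post (d_qry D x) m) X.
Proof. by move=> mX s; case: (mX (Qry x :: s)). Qed.

Lemma legit_res m X x : legit m X -> res (d_qry D x) m = (x \in X).
Proof. by move=> mX; case: (mX [:: Qry x]). Qed.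

Definition contents m : {set 'I_U} := [set x | res (d_qry D x) m].

Lemma legit_contents m X : legit m X -> contents m = X.
Proof. by move=> mX; apply/setP => x; rewrite inE (legit_res x mX). Qed.

Lemma eq_contents m m' : m =1 m' -> contents m = contents m'.
Proof.
move=> mm'; apply/setP => x; rewrite !inE.
by case: (@run_agree _ _ _ (d_qry D x) m m' setT) => // ->.
Qed.

Lemma cost_ins_gt0 m X x :
  legit m X -> x \notin X -> #|X| < n -> 0 < cost (d_ins D x) m.
Proof.
move=> mX xX cX; rewrite lt0n; apply/eqP => /post_cost0 e.
have := legit_contents (legit_ins mX xX cX).
by rewrite e (legit_contents mX) => /setP/(_ x); rewrite setU11 (negbTE xX).
Qed.

Definition round (da : 'I_U * 'I_U) : prog S W unit :=
  andthen (d_qry D da.1) (andthen (d_del D da.1) (d_ins D da.2)).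

Fixpoint inserts (s : seq 'I_U) : prog S W unit :=
  if s is x :: s' then andthen (d_ins D x) (inserts s') else Ret S W tt.

Fixpoint rounds (s : seq ('I_U * 'I_U)) : prog S W unit :=
  if s is da :: s' then andthen (round da) (rounds s') else Ret S W tt.

Lemma post_rounds_cat s1 s2 m :
  post (rounds (s1 ++ s2)) m = post (rounds s2) (post (rounds s1) m).
Proof. by elim: s1 m => //= da s IH m; rewrite !post_andthen IH. Qed.

Lemma cost_rounds_cat s1 s2 m :
  cost (rounds (s1 ++ s2)) m =
  cost (rounds s1) m + cost (rounds s2) (post (rounds s1) m).
Proof.
elim: s1 m => //= da s IH m.
by rewrite !cost_andthen IH addnA !post_andthen.
Qed.

Lemma touched_rounds_cat s1 s2 m :
  touched (rounds (s1 ++ s2)) m =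
  touched (rounds s1) m :|: touched (rounds s2) (post (rounds s1) m).
Proof.
elim: s1 m => [|da s IH] m /=; first by rewrite set0U.
by rewrite !touched_andthen IH setUA !post_andthen.
Qed.

Lemma legit_round m X d a : legit m X -> d \in X -> #|X| <= n -> a \notin X ->
  legit (post (round (d, a)) m) (a |: X :\ d).
Proof.
move=> mX dX cX aX; rewrite !post_andthen /=.
apply: legit_ins; first by apply: legit_del => //; apply: legit_qry.
- by rewrite !inE negb_and aX orbT.
- by rewrite (cardsD1 d X) dX in cX.
Qed.

End Dictionary.

(** * Counting *)

Section Counting.

(** [C0] may be enlarged by any part of the complement of [C]. Thus a random set has a prescribed
    trace on [C] with probability at least [2 ^ - #|C|]. *)
Lemma card_set_trace (T : finType) (C C0 : {set T}) : C0 \subset C ->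
  2 ^ (#|T| - #|C|) <= #|[set L : {set T} | L :&: C == C0]|.
Proof.
move=> C0C; have -> : #|T| - #|C| = #|~: C| by rewrite -(cardsC C) addKn.
rewrite -card_powerset.
rewrite -(@card_in_imset _ _ (fun Z => C0 :|: Z) (powerset (~: C))); last first.
  move=> Z1 Z2; rewrite !inE => Z1C Z2C /(congr1 (fun Z : {set T} => Z :\: C)).
  rewrite !setDUl (_ : C0 :\: C = set0) ?set0U; last by apply/eqP; rewrite setD_eq0.
  have dZ (Z : {set T}) : Z \subset ~: C -> Z :\: C = Z by rewrite setDE => /setIidPl.
  by rewrite !dZ.
apply/subset_leq_card/subsetP => L /imsetP[Z]; rewrite !inE => ZC ->.
apply/eqP; rewrite setIUl; move/setIidPl: (C0C) => ->.
suff -> : Z :&: C = set0 by rewrite setU0.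
by apply/eqP; rewrite setI_eq0 disjoints_subset.
Qed.

(** Cauchy-Schwarz against the constant 1, doubled so that it reduces termwise to
    [2xy <= x^2 + y^2]. *)
Lemma leq_sqr_sum (T : finType) (A : {set T}) (g : T -> nat) :
  (\sum_(i in A) g i) ^ 2 <= #|A| * \sum_(i in A) g i ^ 2.
Proof.
rewrite -(leq_pmul2l (isT : 0 < 2)).
have -> : (\sum_(i in A) g i) ^ 2 = \sum_(i in A) \sum_(j in A) g i * g j.
  by rewrite -mulnn big_distrl; apply: eq_bigr => i _; rewrite big_distrr.
have -> : 2 * (#|A| * \sum_(i in A) g i ^ 2) =
    \sum_(i in A) \sum_(j in A) (g i ^ 2 + g j ^ 2).
  under [in RHS]eq_bigr => i _ do rewrite big_split /= sum_nat_const.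
  by rewrite big_split /= -big_distrr sum_nat_const /= mul2n -addnn.
rewrite big_distrr; apply: leq_sum => i _; rewrite big_distrr.
by apply: leq_sum => j _; apply: nat_Cauchy.
Qed.

(** Union bound over the [2 ^ l] possible agreement sets [J]: a function agreeing with [c] on [J] is
    free only at the other coordinates, at most [l - j] of them. *)
Lemma card_agree (l q j : nat) (c : {ffun 'I_l -> 'I_q}) : 0 < q ->
  #|[set c' : {ffun 'I_l -> 'I_q} | j <= #|[set i | c i == c' i]|]| * q ^ j
    <= 2 ^ l * q ^ l.
Proof.
move=> q0; set B := [set c' | _].
have -> : #|B| = \sum_(J : {set 'I_l}) #|[set c' in B | [set i | c i == c' i] == J]|.
  rewrite -sum1_card (partition_big (fun c' : {ffun 'I_l -> 'I_q} => [set i | c i == c' i]) predT) //=.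
  by apply: eq_bigr => J _; rewrite -sum1_card; apply: eq_bigl => c'; rewrite !inE.
have -> : 2 ^ l = #|{set 'I_l}| by rewrite -cardsT -powersetT card_powerset cardsT card_ord.
rewrite big_distrl /= -sum_nat_const; apply: leq_sum => J _.
set BJ := [set c' in _ | _].
have [->|[c0]] := set_0Vmem BJ; first by rewrite cards0.
rewrite !inE => /andP[jc0 /eqP e0]; rewrite e0 in jc0.
have sBJ : BJ \subset [set c' in family (fun i => if i \in J then pred1 (c i) else predT)].
  apply/subsetP => c'; rewrite !inE => /andP[_ /eqP eJ].
  by apply/familyP => i; case: ifP; rewrite // -eJ inE eq_sym.
apply: leq_trans (leq_mul (subset_leq_card sBJ) (leqnn _)) _.
rewrite cardsE card_family foldrE big_map big_enum /=.
rewrite (bigID (fun i => i \in J)) /=.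
under eq_bigr => i iJ do rewrite iJ card1.
rewrite prod_nat_const exp1n mul1n.
under eq_bigr => i iJ do rewrite (negbTE iJ) card_ord.
rewrite prod_nat_const -expnD leq_pexp2l //.
have := cardsC J; rewrite card_ord => eC.
rewrite -[X in _ <= X]eC addnC leq_add //.
by apply: eq_leq; apply: eq_card => i; rewrite !inE.
Qed.

Lemma card_set_sum (T : finType) (P : pred T) : #|[set x | P x]| = \sum_x P x.
Proof. by rewrite -sum1_card big_mkcond; apply: eq_bigr => x _; rewrite inE; case: (P x). Qed.

Lemma sum_eq_mul (T : finType) (v : T) (F : T -> nat) : \sum_x (v == x) * F x = F v.
Proof.
rewrite (bigD1 v) //= eqxx mul1n big1 ?addn0 // => x xv.
by rewrite eq_sym (negbTE xv).
Qed.

(** The form in which encodings are counted: [i] is a code and [F i] holds the objects it may stand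
    for. *)
Lemma card_le_cover (T I : finType) (A : {set T}) (F : I -> {set T}) :
  (forall x, x \in A -> exists i, x \in F i) -> #|A| <= \sum_i #|F i|.
Proof.
move=> h; have -> : \sum_i #|F i| = \sum_i \sum_(x in F i) 1.
  by apply: eq_bigr => i _; rewrite sum1_card.
rewrite (eq_bigr (fun i => \sum_x (x \in F i))); last first.
  by move=> i _; rewrite big_mkcond; apply: eq_bigr => x _; case: (x \in _).
rewrite exchange_big /= -sum1_card big_mkcond; apply: leq_sum => x _.
case: ifP => // /h[i xi]; by rewrite (bigD1 i) //= xi.
Qed.
Local Open Scope group_scope.

(** Two members differ by a permutation that fixes [A] pointwise and stabilizes [B], that is, by a
    permutation of [B] and one of the remaining points. *)
Lemma card_perm_fix (T : finType) (A B X : {set T}) (f : T -> T) :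
  [disjoint A & B] ->
  #|[set s : {perm T} | (s @: B == X) && [forall p in A, s p == f p]]|
    <= #|B|`! * (#|T| - #|A| - #|B|)`!.
Proof.
move=> dAB; set E := [set s | _].
have [->|[s0 s0E]] := set_0Vmem E; first by rewrite cards0.
move: (s0E); rewrite inE => /andP[/eqP s0B /forall_inP s0A].
set C := ~: (A :|: B).
have cC : #|C| = (#|T| - #|A| - #|B|)%N.
  by rewrite cardsCs setCK cardsU (disjoint_setI0 dAB) cards0 subn0 subnDA.
rewrite -cC -(card_perm B) -(card_perm C) -[#|perm_on B|]cardsE -[#|perm_on C|]cardsE.
pose h (s : {perm T}) := (restr_perm B (s * s0^-1)%g, restr_perm C (s * s0^-1)%g).
rewrite -cardsX -(@card_in_imset _ _ h E).
  apply/subset_leq_card/subsetP => _ /imsetP[s _ ->].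
  by rewrite !inE /= ![_ \in perm_on _]restr_perm_on.
have eE s : s \in E -> [/\ (s * s0^-1)%g \in 'N(B | 'P), (s * s0^-1)%g \in 'N(C | 'P)
    & forall p, p \in A -> (s * s0^-1)%g p = p].
  rewrite inE => /andP[/eqP sB /forall_inP sA].
  have tA p : p \in A -> (s * s0^-1)%g p = p.
    by move=> pA; rewrite permM (eqP (sA _ pA)) -(eqP (s0A _ pA)) permK.
  have tB p : ((s * s0^-1)%g p \in B) = (p \in B).
    rewrite permM -(mem_imset _ _ (@perm_inj _ s0)) permKV s0B -sB.
    by rewrite mem_imset //; apply: perm_inj.
  have tA' p : ((s * s0^-1)%g p \in A) = (p \in A).
    apply/idP/idP => [|pA]; last by rewrite tA.
    by move=> pA; have /perm_inj <- := tA _ pA.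
  split=> //; apply/astabsP => p /=; rewrite /aperm ?tB //.
  by rewrite !inE tA' tB.
move=> s t /eE[sB sC sA] /eE[tB tC tA] [eB eC].
apply: (mulIg s0^-1%g); apply/permP => p.
have [pB|pB] := boolP (p \in B); first by rewrite -(restr_permE sB) // eB restr_permE.
have [pA|pA] := boolP (p \in A); first by rewrite sA ?tA.
have pC : p \in C by rewrite !inE negb_or pA.
by rewrite -(restr_permE sC) // eC restr_permE.
Qed.

End Counting.

(** * Histories *)

Section World.
Variables (U S W n : nat) (D : dict U S W) (u0 : 'I_U) (p : nat -> nat).
Hypothesis D_correct : correct_dict n D.
Hypothesis n2U : 2 * n <= U.
Hypothesis p_lt : forall j, j < n -> p j < n.
Hypothesis p_inj : {in gtn n &, injective p}.
Implicit Types (s : {perm 'I_U}) (m : mem S W).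

(* [s] lists the keys: those at positions below [n] are loaded first, round [j] deletes the
   one at position [p j] and inserts the one at position [n + j].  [u0] is only the junk
   value of [at_] out of range. *)
Definition at_ i : 'I_U := insubd u0 i.

Lemma val_at i : i < U -> at_ i = i :> nat.
Proof. by move=> iU; rewrite /at_ val_insubd iU. Qed.

Lemma at_inj : {in gtn U &, injective at_}.
Proof. by move=> i j iU jU /(congr1 (@nat_of_ord U)); rewrite !val_at. Qed.

Definition key s i := s (at_ i).

Lemma key_inj s : {in gtn U &, injective (key s)}.
Proof. by move=> i j iU jU /perm_inj /at_inj; apply. Qed.

Definition step s j := (key s (p j), key s (n + j)).

Definition steps s b l := [seq step s j | j <- iota b l].

Definition loaded s := post (inserts D [seq key s i | i <- iota 0 n]) (d_init D).

Definition state s i := post (rounds D (steps s 0 i)) (loaded s).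

Lemma state_add s b l : state s (b + l) = post (rounds D (steps s b l)) (state s b).
Proof. by rewrite /state /steps iotaD map_cat post_rounds_cat. Qed.

Lemma stateS s i : state s i.+1 = post (round D (step s i)) (state s i).
Proof. by rewrite -addn1 state_add /= post_andthen. Qed.

(** Positions are tracked instead of keys: the keys present after [i] rounds are [s @: slots i],
    with the same positions for every [s]. *)
Fixpoint slots i : {set 'I_U} :=
  if i is i'.+1 then at_ (n + i') |: slots i' :\ at_ (p i') else [set x : 'I_U | x < n].

Lemma mem_slots i x : i <= n ->
  (x \in slots i) = ((x < n) && [forall j : 'I_i, (x : nat) != p j]) || (n <= x < n + i).
Proof.
elim: i => [|i IH] lin /=.
  rewrite inE addn0 andbC ltnNge andbN orbF.
  by rewrite (_ : [forall j, _]) //; apply/forallP => -[].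
have ax k : k < U -> (x == at_ k) = ((x : nat) == k) by move=> kU; rewrite -val_eqE /= val_at.
have pin := p_lt lin.
rewrite 3!inE inE !ax; [|lia|lia]; rewrite IH ?(ltnW lin) //.
have -> : [forall j : 'I_i.+1, (x : nat) != p j] =
    ((x : nat) != p i) && [forall j : 'I_i, (x : nat) != p j].
  apply/forallP/andP => [h|[h1 /forallP h2] [j jlt] /=].
    split; first exact: (h ord_max).
    by apply/forallP => j; apply: (h (widen_ord (leqnSn i) j)).
  by move: jlt; rewrite ltnS leq_eqVlt => /orP[/eqP->//|ji]; apply: (h2 (Ordinal ji)).
by case: [forall j : 'I_i, _]; have := ltn_ord x; rewrite ?andbT ?andbF /=; lia.
Qed.

Lemma slot_del i : i < n -> at_ (p i) \in slots i.
Proof.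
move=> lin; have pin := p_lt lin.
rewrite mem_slots ?(ltnW lin) //; apply/orP; left.
rewrite val_at ?pin /=; last by lia.
apply/forallP => -[j ji] /=; apply/eqP => /p_inj e.
have : i = j by apply: e; rewrite inE //; lia.
by lia.
Qed.

Lemma slot_ins i : i < n -> at_ (n + i) \notin slots i.
Proof.
move=> lin; rewrite mem_slots ?(ltnW lin) // val_at; last by lia.
by rewrite ltnNge leq_addr ltnn.
Qed.

Lemma card_slots i : i <= n -> #|slots i| = n.
Proof.
elim: i => [|i IH] lin /=.
  have -> : [set x : 'I_U | x < n] = [set at_ (nat_of_ord j) | j : 'I_n].
    apply/setP => x; rewrite inE; apply/idP/imsetP => [xn|[j _ ->]].
      exists (Ordinal xn) => //; apply: ord_inj; rewrite val_at //=; lia.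
    by rewrite val_at; have := ltn_ord j; lia.
  rewrite card_imset ?card_ord // => i j /at_inj e; apply: ord_inj.
  by apply: e; rewrite inE; [have := ltn_ord i | have := ltn_ord j]; lia.
rewrite cardsU1 !inE (negbTE (slot_ins lin)) andbF /=.
by have := cardsD1 (at_ (p i)) (slots i); rewrite slot_del // IH ?(ltnW lin).
Qed.

Lemma legit_inserts m X (xs : seq 'I_U) :
  legit n D m X -> uniq xs -> all (fun x => x \notin X) xs -> #|X| + size xs <= n ->
  legit n D (post (inserts D xs) m) (X :|: [set x in xs]).
Proof.
elim: xs m X => [|x xs IH] m X mX /=.
  by rewrite (_ : [set x in [::]] = set0) ?setU0 //; apply/setP => x; rewrite !inE.
move=> /andP[xxs uxs] /andP[xX axs] cX; rewrite post_andthen.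
have -> : X :|: [set y in x :: xs] = (x |: X) :|: [set y in xs].
  by apply/setP => y; rewrite !inE orbCA orbA.
apply: IH => //; first by apply: legit_ins => //; apply: leq_trans cX; rewrite addnS ltnS leq_addr.
- apply/allP => y yxs; rewrite !inE negb_or (allP axs) // andbT.
  by apply: contraNneq xxs => <-.
- by rewrite cardsU1 xX add1n addSnnS.
Qed.

Lemma legit_state s i : i <= n -> legit n D (state s i) (s @: slots i).
Proof.
elim: i => [|i IH] lin.
  have -> : s @: slots 0 = set0 :|: [set x in [seq key s i | i <- iota 0 n]].
    rewrite set0U; apply/setP => x; rewrite inE.
    apply/imsetP/mapP => -[y]; rewrite ?inE ?mem_iota.
      move=> yn ->; exists (y : nat); first by rewrite mem_iota.
      by congr (s _); apply: ord_inj; rewrite val_at.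
    by move=> yn ->; exists (at_ y) => //; rewrite inE val_at; lia.
  apply: legit_inserts; rewrite ?cards0 ?size_map ?size_iota //.
  - rewrite map_inj_in_uniq ?iota_uniq // => x y; rewrite !mem_iota => xn yn.
    by move/key_inj; apply; rewrite inE; lia.
  - by apply/allP => x; rewrite inE.
rewrite stateS /=.
have -> : s @: (at_ (n + i) |: slots i :\ at_ (p i)) =
    key s (n + i) |: (s @: slots i) :\ key s (p i).
  rewrite imsetU1; congr (_ |: _); apply/setP => x; rewrite !inE.
  rewrite -(permKV s x) !mem_imset ?inE ?(inj_eq perm_inj) //; exact: perm_inj.
apply: legit_round; first by apply: IH; lia.
- by rewrite mem_imset ?slot_del //; apply: perm_inj.
- by rewrite card_imset ?card_slots //; [lia|apply: perm_inj].
- by rewrite mem_imset ?slot_ins //; apply: perm_inj.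
Qed.

Definition candidates (L : {set 'I_S}) m : seq 'I_U :=
  [seq x <- enum 'I_U | res (d_qry D x) m && (touched (d_qry D x) m \subset L)].

(** The decoder's simulation: inserted keys are given, while each deleted key is read off the
    current memory through its index among the candidates. *)
Fixpoint replay (L : {set 'I_S}) (idx : seq nat) (ins : seq 'I_U) m
  : seq 'I_U * mem S W :=
  match idx, ins with
  | i :: idx', a :: ins' =>
    let d := nth u0 (candidates L m) i in
    let r := replay L idx' ins' (post (round D (d, a)) m) in (d :: r.1, r.2)
  | _, _ => ([::], m)
  end.

(* A memory that agrees with a legal one on [L] can only recognize, within [L],
   keys which are really present; so naming the next deleted key among the
   candidates takes one of [n] indices. *)
Lemma replay_complete s (L : {set 'I_S}) l b m : b + l <= n ->
  {in L, state s b =1 m} ->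
  touched (rounds D (steps s b l)) (state s b) \subset L ->
  exists idx : l.-tuple 'I_n,
    replay L [seq val i | i <- idx] [seq key s (n + j) | j <- iota b l] m =
    ([seq key s (p j) | j <- iota b l], post (rounds D (steps s b l)) m).
Proof.
elim: l b m => [|l IH] b m bl agr; first by exists [tuple].
rewrite [rounds _ _]/= touched_andthen -stateS subUset => /andP[tr trs].
have bn : b < n by lia.
have [//|_ _ agr'] := @run_agree _ _ _ (round D (step s b)) _ m L agr.
rewrite -stateS in agr'.
have [|idx' e] := IH b.+1 (post (round D (step s b)) m) _ agr' trs; first by lia.
set d := key s (p b).
have legb := legit_state s (ltnW bn).
have dX : d \in s @: slots b by rewrite mem_imset ?slot_del //; apply: perm_inj.
have tq : touched (d_qry D d) (state s b) \subset L.
  by apply: subset_trans tr; rewrite touched_andthen subsetUl.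
have [//|rq tq' _] := @run_agree _ _ _ (d_qry D d) _ m L agr.
have dc : d \in candidates L m.
  by rewrite mem_filter mem_enum rq tq' tq (legit_res d legb) dX.
have szc : size (candidates L m) <= n.
  rewrite -(card_slots (ltnW bn)) -(card_imset _ (@perm_inj _ s)) cardE.
  apply: uniq_leq_size; first by rewrite filter_uniq ?enum_uniq.
  move=> x; rewrite mem_filter mem_enum => /andP[/andP[xr xt] _].
  have agr'' : {in L, m =1 state s b} by move=> y yL; rewrite agr.
  have [//|rx _ _] := @run_agree _ _ _ (d_qry D x) _ (state s b) L agr''.
  by rewrite mem_enum -(legit_res x legb) rx.
have idn : index d (candidates L m) < n by rewrite (leq_trans _ szc) ?index_mem.
exists [tuple of Ordinal idn :: idx'] => /=.
by rewrite nth_index // e /= post_andthen.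
Qed.

(** [E] lists at most [k] corrected cells; [None] fills the spare entries. *)
Definition patch k (E : {ffun 'I_k -> option ('I_S * 'I_W)}) m : mem S W := fun c =>
  if [pick i | omap fst (E i) == Some c] is Some i
  then oapp snd (m c) (E i) else m c.

Lemma patch_exists k m m' : #|[set c | m c != m' c]| <= k ->
  exists E : {ffun 'I_k -> option ('I_S * 'I_W)}, patch E m =1 m'.
Proof.
set B := [set c | _] => Bk.
pose f c := Some (c, m' c).
exists [ffun i : 'I_k => nth None [seq f c | c <- enum B] i] => c.
rewrite /patch; case: pickP => [i|h].
  rewrite !ffunE; have [iB|iB] := ltnP i (size (enum B)).
    rewrite (nth_map c) //= => /eqP[ec].
    by rewrite ec.
  by rewrite nth_default ?size_map.
have [cB|] := boolP (c \in B); last by rewrite inE negbK => /eqP.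
have ic : index c (enum B) < k by rewrite (leq_trans _ Bk) // cardE index_mem mem_enum.
have := h (Ordinal ic); rewrite ffunE /= (nth_map c) ?index_mem ?mem_enum //=.
by rewrite nth_index ?mem_enum // eqxx.
Qed.

(** [L'] stands for the cells probed by the order that is not replayed. Cells probed by the replayed
    order alone must return to their contents before the replay, hence the choice of [N] off
    [L']. *)
Definition decode k (L L' : {set 'I_S}) (N : {ffun 'I_S -> 'I_W}) idx ins
    (E : {ffun 'I_k -> option ('I_S * 'I_W)}) : {set 'I_U} * seq 'I_U :=
  let r := replay L idx ins N in
  (contents D (patch E (fun c => if c \in L' then r.2 c else N c)), r.1).

Definition probed s b l := touched (rounds D (steps s b l)) (state s b).

Lemma state_add_untouched s b l c : c \notin probed s b l ->
  state s (b + l) c = state s b c.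
Proof. by move=> cP; rewrite state_add post_untouched. Qed.

(* [N] holds the contents before the rounds [b, b+l) of the history [s'] on the cells this
   history probes, and the contents after the same rounds of the history [s] elsewhere;
   [E] repairs the cells probed again before the two histories merge. *)
Lemma decode_complete k s s' b l r (L L' : {set 'I_S}) :
  b + l + r <= n ->
  state s b = state s' b ->
  state s (b + l + r) =1 state s' (b + l + r) ->
  (forall j, j < n -> key s (p j) = key s' (p j)) ->
  let C := probed s b l in let C' := probed s' b l in
  L :&: (C :|: C') = C' -> L' :&: (C :|: C') = C ->
  #|C :&: probed s (b + l) r| + #|C' :&: probed s' (b + l) r| <= k ->
  exists (N : {ffun 'I_S -> 'I_W}) (idx : l.-tuple 'I_n)
      (E : {ffun 'I_k -> option ('I_S * 'I_W)}),
    decode L L' N [seq val i | i <- idx] [seq key s' (n + j) | j <- iota b l] E =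
    (s @: slots (b + l), [seq key s (p j) | j <- iota b l]).
Proof.
move=> blr e0 e2 ed C C' eL eL' hk.
have inL c : (c \in L) && ((c \in C) || (c \in C')) = (c \in C').
  by rewrite -[RHS](congr1 (fun A : {set _} => c \in A) eL) !inE.
have inL' c : (c \in L') && ((c \in C) || (c \in C')) = (c \in C).
  by rewrite -[RHS](congr1 (fun A : {set _} => c \in A) eL') !inE.
pose N : {ffun 'I_S -> 'I_W} :=
  [ffun c => if c \in C' then state s' b c else state s (b + l) c].
have agr : {in L, state s' b =1 N}.
  move=> c cL; rewrite ffunE; case: ifPn => // cC'.
  rewrite state_add_untouched ?e0 //.
  by have := inL c; rewrite cL (negbTE cC') orbF /= => ->.
have subL : C' \subset L by apply/subsetP => c cC'; have := inL c; rewrite cC' => /andP[].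
have [|idx eidx] := replay_complete _ agr subL; first by lia.
have [_ tN agr'] := run_agree agr subL.
rewrite -state_add in agr'.
pose M c := if c \in L' then post (rounds D (steps s' b l)) N c else N c.
have out c : c \notin C' -> post (rounds D (steps s' b l)) N c = state s (b + l) c.
  by move=> cC'; rewrite post_untouched ?tN // ffunE (negbTE cC').
have sub : [set c | M c != state s (b + l) c] \subset
    (C :&: probed s (b + l) r) :|: (C' :&: probed s' (b + l) r).
  apply/subsetP => c; rewrite !inE /M; apply: contraNT => /norP[].
  rewrite !negb_and; have [cC'|cC'] := boolP (c \in C'); last first.
    by move=> _ _; rewrite out // ffunE (negbTE cC') if_same.
  have := inL' c; rewrite cC' orbT andbT => ->.
  (* A cell probed by both histories but by neither afterwards already holds, in both, its contents
     in the common final memory. *)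
  have [cC /= h1 h2|cC _ _] := boolP (c \in C).
    rewrite -agr' ?(subsetP subL) //.
    by rewrite -(state_add_untouched h1) -(state_add_untouched h2) e2.
  by rewrite ffunE cC' state_add_untouched // e0.
have [|E eE] := @patch_exists k M (state s (b + l)).
  by apply: leq_trans hk; apply: leq_trans (subset_leq_card sub) (leq_card_setU _ _).
exists N, idx, E; rewrite /decode eidx /=; congr pair.
  have bl : b + l <= n by lia.
  by rewrite -(legit_contents (legit_state s bl)); apply: eq_contents.
apply/eq_in_map => j; rewrite mem_iota => jl; rewrite ed //; lia.
Qed.

Lemma eq_state s s' i : i <= n -> (forall x, x < n + i -> key s x = key s' x) ->
  state s i = state s' i.
Proof.
move=> lin h; rewrite /state /loaded /steps.
have -> : [seq key s x | x <- iota 0 n] = [seq key s' x | x <- iota 0 n].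
  by apply/eq_in_map => x; rewrite mem_iota => xn; apply: h; lia.
have -> // : [seq step s x | x <- iota 0 i] = [seq step s' x | x <- iota 0 i].
apply/eq_in_map => x; rewrite mem_iota => xi.
have px : p x < n by apply: p_lt; lia.
by rewrite /step !h //; lia.
Qed.

(** * The inequality for one block *)

Section Block.
Variables (b l q : nat).
Hypothesis l_gt0 : 0 < l.
Hypothesis bqn : b + q * l <= n.
Implicit Types (c : {ffun 'I_l -> 'I_q}).

(* The [q * l] insertions of the block form a [q] by [l] grid;
   column [i] is rotated by [c i]. *)
Definition shift c x :=
  if n + b <= x < n + b + q * l then
    let y := x - (n + b) in
    n + b + ((y %/ l + oapp (fun i => val (c i)) 0 (insub (y %% l))) %% q * l + y %% l)
  else x.

Lemma grid_lt r i : r < q -> i < l -> r * l + i < q * l.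
Proof.
move=> rq il; apply: (@leq_trans (r.+1 * l)); first by rewrite mulSn; lia.
by rewrite leq_mul2r rq orbT.
Qed.

Lemma grid_inj r i r' i' : i < l -> i' < l -> r * l + i = r' * l + i' -> r = r' /\ i = i'.
Proof.
move=> il il' e; split.
  by have := congr1 (fun x => x %/ l) e; rewrite !divnMDl // !divn_small // !addn0.
by have := congr1 (fun x => x %% l) e; rewrite !modnMDl !modn_small.
Qed.

Lemma shift_out c x : ~~ (n + b <= x < n + b + q * l) -> shift c x = x.
Proof. by rewrite /shift => /negbTE ->. Qed.

Lemma shift_block c x : (n + b <= shift c x < n + b + q * l) = (n + b <= x < n + b + q * l).
Proof.
rewrite {1 2}/shift; case: ifP => [|->//] h; rewrite leq_addr ltn_add2l.
by rewrite grid_lt ?ltn_pmod //; case: (q) h; lia.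
Qed.

Lemma shift_inj c : injective (shift c).
Proof.
move=> x y e; have hx := shift_block c x; have hy := shift_block c y.
rewrite e hy in hx; have [bx|bx] := boolP (n + b <= x < n + b + q * l); last first.
  by rewrite -(shift_out c bx) e shift_out // hx.
have by_ : n + b <= y < n + b + q * l by rewrite hx.
move: e; rewrite /shift bx by_ => /addnI.
move=> /grid_inj[||eq em]; rewrite ?ltn_pmod //.
move: eq; rewrite em => /eqP; rewrite eqn_modDr => /eqP.
have qlt z : n + b <= z < n + b + q * l -> (z - (n + b)) %/ l < q.
  by move=> hz; rewrite ltn_divLR //; lia.
rewrite !modn_small ?qlt // => eq.
have := divn_eq (x - (n + b)) l; have := divn_eq (y - (n + b)) l.
by rewrite eq em; lia.
Qed.

(** The first group takes from column [i] the key in row [c i], so two rotations share first-group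
    keys exactly in the columns where they agree. *)
Lemma shift_first c (i : 'I_l) : shift c (n + b + i) = n + b + (c i * l + i).
Proof.
have il := ltn_ord i; have cq := ltn_ord (c i).
have hb : n + b <= n + b + i < n + b + q * l.
  by have := grid_lt cq il; lia.
by rewrite /shift hb addKn divn_small // add0n (modn_small il) valK /= modn_small.
Qed.

Lemma shift_lt c x : x < U -> shift c x < U.
Proof.
move=> xU; have [bx|bx] := boolP (n + b <= x < n + b + q * l); last by rewrite shift_out.
by have := shift_block c x; rewrite bx => /andP[_]; lia.
Qed.

Definition rotation_fun c (x : 'I_U) := at_ (shift c x).

Lemma rotation_inj c : injective (rotation_fun c).
Proof. by move=> x y /at_inj e; apply/ord_inj/(@shift_inj c)/e; rewrite inE shift_lt. Qed.

Definition rotation c : {perm 'I_U} := perm (@rotation_inj c).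

Definition rot c s : {perm 'I_U} := (rotation c * s)%g.

Lemma key_rot c s x : x < U -> key (rot c s) x = key s (shift c x).
Proof. by move=> xU; rewrite /key permM permE /rotation_fun val_at. Qed.

Lemma rot_imset c s (A : {set 'I_U}) : rot c s @: A = s @: (rotation c @: A).
Proof. by rewrite -imset_comp; apply: eq_imset => x; rewrite /= permM. Qed.

(** All positions of the block are occupied once it ends, so permuting them changes nothing. *)
Lemma rotation_slots c : rotation c @: slots (b + q * l) = slots (b + q * l).
Proof.
apply/setP => x; rewrite -(permKV (rotation c) x) mem_imset; last exact: perm_inj.
set y := (rotation c)^-1%g x.
have [yB|yB] := boolP (n + b <= y < n + b + q * l); last first.
  by rewrite permE /rotation_fun shift_out // (_ : at_ y = y) //; apply: ord_inj; rewrite val_at.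
have := shift_block c y; rewrite yB => hs.
rewrite permE /rotation_fun !mem_slots // val_at ?shift_lt //; lia.
Qed.

Lemma rot_state c s : state (rot c s) b = state s b.
Proof.
apply: eq_state => [|x xb]; first by lia.
by rewrite key_rot ?shift_out //; lia.
Qed.

Lemma rot_deleted c s j : j < n -> key (rot c s) (p j) = key s (p j).
Proof. by move=> /p_lt pj; rewrite key_rot ?shift_out //; lia. Qed.

Variables (T e : nat).

Definition good s :=
  (#|probed s b l| <= T) && (#|probed s b l :&: probed s (b + l) (q * l - l)| <= e).

Definition final s : {ffun 'I_S -> 'I_W} := [ffun x => state s (b + q * l) x].

Definition collide s c c' :=
  [&& good (rot c s), good (rot c' s) & final (rot c s) == final (rot c' s)].

Lemma contents_final c s : contents D (final (rot c s)) = s @: slots (b + q * l).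
Proof.
rewrite -(rotation_slots c) -rot_imset.
rewrite -(legit_contents (legit_state (rot c s) bqn)).
by apply: eq_contents => x; rewrite ffunE.
Qed.

Lemma card_rotations : #|{ffun 'I_l -> 'I_q}| = q ^ l.
Proof. by rewrite card_ffun !card_ord. Qed.

(* Rotations do not change the set of keys present after the block, and few memories
   can represent a given set; so many rotations end up in the same memory. *)
Lemma collide_lower :
  (q ^ l * #|[set s | good s]|) ^ 2 <=
  W ^ S * (n`! * (U - n)`!) * \sum_s \sum_c \sum_c' collide s c c'.
Proof.
(* [I] pairs a history with the memories representing its keys after the block, and [g] counts the
   good rotations ending in a given memory. The squares of [g] sum to the number of collisions,
   which Cauchy-Schwarz bounds below. *)
set I := [set x : {perm 'I_U} * {ffun 'I_S -> 'I_W} |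
  x.1 @: slots (b + q * l) == contents D x.2].
pose g (x : {perm 'I_U} * {ffun 'I_S -> 'I_W}) :=
  \sum_c (final (rot c x.1) == x.2) * good (rot c x.1).
have sumI F : \sum_(x in I) F x = \sum_s \sum_f ((s, f) \in I) * F (s, f).
  rewrite big_mkcond pair_big /=; apply: eq_bigr => -[s f] _ /=.
  by case: ifP => _; rewrite ?mul1n.
have inI c s : (s, final (rot c s)) \in I by rewrite inE /= contents_final.
have sum_g : \sum_(x in I) g x = q ^ l * #|[set s | good s]|.
  rewrite sumI.
  have -> : \sum_s \sum_f ((s, f) \in I) * g (s, f) = \sum_s \sum_c good (rot c s).
    apply: eq_bigr => s _.
    under eq_bigr => f _ do rewrite big_distrr /=.
    rewrite exchange_big; apply: eq_bigr => c _ /=.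
    under eq_bigr => f _ do rewrite mulnCA.
    by rewrite sum_eq_mul inI mul1n.
  rewrite exchange_big -card_rotations -sum_nat_const /=.
  apply: eq_bigr => c _; rewrite card_set_sum.
  rewrite [RHS](reindex (rot c)) //=.
  exists (mulg (rotation c)^-1%g) => s _; [exact: mulKg | exact: mulKVg].
have sum_g2 : \sum_(x in I) g x ^ 2 = \sum_s \sum_c \sum_c' collide s c c'.
  rewrite sumI; apply: eq_bigr => s _.
  have e2 f : ((s, f) \in I) * g (s, f) ^ 2 = \sum_c \sum_c'
      (final (rot c s) == f) * (((s, f) \in I) *
        (good (rot c s) * (final (rot c' s) == f) * good (rot c' s))).
    rewrite -mulnn /g big_distrl big_distrr /=; apply: eq_bigr => c _.
    rewrite !big_distrr /=; apply: eq_bigr => c' _; lia.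
  under eq_bigr => f _ do rewrite e2.
  rewrite exchange_big; apply: eq_bigr => c _; rewrite exchange_big.
  apply: eq_bigr => c' _ /=; rewrite sum_eq_mul inI mul1n /collide eq_sym.
  by case: good; case: good; case: eqP.
rewrite -sum_g -sum_g2; apply: leq_trans (leq_sqr_sum I g) _.
rewrite leq_mul2r; apply/orP; right.
rewrite -sum1_card sumI exchange_big /=.
have -> : W ^ S = #|{ffun 'I_S -> 'I_W}| by rewrite card_ffun !card_ord.
rewrite -sum_nat_const; apply: leq_sum => f _.
have -> : \sum_s ((s, f) \in I) * 1 =
    #|[set s : {perm 'I_U} | (s @: slots (b + q * l) == contents D f)
        && [forall x in set0, s x == x]]|.
  rewrite card_set_sum; apply: eq_bigr => s _; rewrite inE muln1.
  by rewrite (_ : [forall x in _, _]) ?andbT //; apply/forallP => x; rewrite inE.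
apply: leq_trans (card_perm_fix _ _ _) _; first by rewrite -setI_eq0 set0I.
by rewrite cards0 subn0 card_ord card_slots.
Qed.

Definition agreement c c' := #|[set i | c i == c' i]|.

(** Pairs agreeing in at least [j] columns are set aside; by [card_agree] they are at most a
    fraction [2 ^ l / q ^ j] of all pairs. *)
Lemma collide_split j (q_gt0 : 0 < q) :
  q ^ j * \sum_s \sum_c \sum_c' collide s c c' <=
  q ^ j * \sum_s \sum_c \sum_(c' | agreement c c' < j) collide s c c'
    + U`! * (2 ^ l * (q ^ l) ^ 2).
Proof.
have -> : U`! * (2 ^ l * (q ^ l) ^ 2) =
    \sum_(s : {perm 'I_U}) \sum_(c : {ffun 'I_l -> 'I_q}) 2 ^ l * q ^ l.
  by rewrite !sum_nat_const card_rotations card_Sn; lia.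
rewrite !big_distrr -big_split; apply: leq_sum => s _ /=.
rewrite !big_distrr -big_split; apply: leq_sum => c _ /=.
rewrite (bigID (fun c' => agreement c c' < j)) /= mulnDr leq_add2l.
apply: leq_trans (card_agree j c q_gt0); rewrite mulnC leq_mul2r; apply/orP; right.
rewrite card_set_sum [X in X <= _]big_mkcond; apply: leq_sum => c' _.
by rewrite -leqNgt; case: (j <= _) => //; case: collide.
Qed.

(** The data prescribe [s] at [l] deleted positions and at the at least [l - j] positions that [c']
    inserts and [c] does not. [X] prescribes, only as a set, the image of [n] further positions. *)
Lemma card_fixed_rotations j c c' (X : {set 'I_U}) (ds ins : seq 'I_U) :
  agreement c c' < j ->
  #|[set s : {perm 'I_U} | [&& rot c s @: slots (b + l) == X,
       [seq key (rot c s) (p i) | i <- iota b l] == ds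
     & [seq key (rot c' s) (n + i) | i <- iota b l] == ins]]|
    <= n`! * (U - n - (2 * l - j))`!.
Proof.
move=> cj; set F := [set s | _].
have [->|[s0 s0F]] := set_0Vmem F; first by rewrite cards0.
case: (posnP q) => [q0|q_gt0].
  by case: (c (Ordinal l_gt0)) => k; rewrite q0.
have lql : l <= q * l by rewrite leq_pmull.
pose a1 (i : 'I_l) := at_ (p (b + i)).
pose a2 (i : 'I_l) := at_ (n + b + (c' i * l + i)).
have a2_lt i : n + b + (c' i * l + i) < n + b + q * l.
  by rewrite ltn_add2l grid_lt.
have a1_lt (i : 'I_l) : p (b + i) < n by apply: p_lt; have := ltn_ord i; lia.
(* Columns where [c] and [c'] agree are left out: their positions belong to those mapped onto
   [X]. *)
set A1 := [set a1 i | i : 'I_l]; set A2 := [set a2 i | i in [set i | c i != c' i]].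
have c1 : #|A1| = l.
  rewrite card_imset ?card_ord // => i i' /at_inj ei.
  have := a1_lt i; have := a1_lt i'; have := ltn_ord i; have := ltn_ord i'.
  move=> h1 h2 h3 h4; apply: ord_inj; apply: (@addnI b).
  by apply: p_inj; rewrite ?inE; try lia; apply: ei; rewrite inE; lia.
have c2 : #|A2| = l - agreement c c'.
  rewrite card_imset => [|i i' /at_inj ei].
    rewrite -[l in RHS]card_ord -(cardsC [set i | c i == c' i]) addKn.
    by apply: eq_card => i; rewrite !inE.
  have /addnI/grid_inj[]// : n + b + (c' i * l + i) = n + b + (c' i' * l + i').
    by apply: ei; rewrite inE; have := a2_lt i; have := a2_lt i'; lia.
  by move=> _ eii; apply: ord_inj.
have d12 : A1 :&: A2 = set0.
  apply/setP => x; rewrite !inE; apply/negP => /andP[/imsetP[i _ ->] /imsetP[i' _]].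
  have := a1_lt i; have := a2_lt i' => h1 h2.
  by move/at_inj => ex; have : p (b + i) = n + b + (c' i' * l + i');
    [apply: ex; rewrite inE|]; lia.
have cA : #|A1 :|: A2| = l + (l - agreement c c') by rewrite cardsU d12 cards0 c1 c2 subn0.
have dis : [disjoint A1 :|: A2 & rotation c @: slots (b + l)].
  rewrite disjoint_sym -setI_eq0; apply/eqP/setP => x; rewrite [RHS]inE.
  apply/negP => /setIP[/imsetP[y yS ->]].
  rewrite permE /rotation_fun => hx.
  move: yS; rewrite mem_slots; last by lia.
  move: hx; rewrite inE => /orP[] /imsetP[i].
    move=> _ /at_inj ey; have ei : shift c y = p (b + i).
      by apply: ey; rewrite inE ?shift_lt //; have := a1_lt i; lia.
    have yn : y < n.
      have := shift_block c y; rewrite ei; have := a1_lt i.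
      have [|yb] := boolP (n + b <= y < n + b + q * l); first by lia.
      by move: ei; rewrite shift_out //; lia.
    have {}ei : y = p (b + i) :> nat by rewrite -ei shift_out //; lia.
    rewrite yn [X in _ || X]andbC [X in _ || X](_ : _ = false); last by lia.
    rewrite orbF => /forallP/(_ (Ordinal (_ : b + i < b + l)))/= h.
    have bi : b + i < b + l by rewrite ltn_add2l.
    by have := h bi; rewrite ei eqxx.
  rewrite inE => cc' /at_inj ey.
  have ei : shift c y = n + b + (c' i * l + i).
    by apply: ey; rewrite inE ?shift_lt //; have := a2_lt i; lia.
  have yb : n + b <= y < n + b + q * l.
    by rewrite -(shift_block c) ei a2_lt leq_addr.
  move=> /orP[|yl]; first by lia.
  have yk : y - (n + b) < l by lia.
  have ek : y = n + b + Ordinal yk :> nat by rewrite /=; lia.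
  move: ei; rewrite ek shift_first => /addnI/grid_inj[]//= ec ek'.
  have eik : Ordinal yk = i by apply: ord_inj.
  by move: ec cc'; rewrite eik => /ord_inj ->; rewrite eqxx.
have sF s : s \in F -> forall x, x \in A1 :|: A2 -> s x = s0 x.
  move: s0F; rewrite !inE => /and3P[_ /eqP d0 /eqP i0] /and3P[_ /eqP d1 /eqP i1] x.
  rewrite inE => /orP[] /imsetP[i _ ->]; have il := ltn_ord i.
    have := d1; rewrite -d0 => /eq_in_map/(_ (b + i)).
    rewrite mem_iota !rot_deleted; [|lia|lia].
    by move=> h; apply: h; lia.
  have := i1; rewrite -i0 => /eq_in_map/(_ (b + i)).
  rewrite mem_iota !key_rot ?addnA ?shift_first; [|lia|lia].
  by move=> h; apply: h; lia.
apply: (@leq_trans (n`! * (U - #|A1 :|: A2| - n)`!)); last first.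
  by rewrite leq_mul2l cA; apply/orP; right; apply: leq_fact; lia.
have cB : #|rotation c @: slots (b + l)| = n.
  by rewrite card_imset ?card_slots //; [lia|exact: perm_inj].
rewrite -[in n`!]cB -[in X in _ - X]cB -[U in U - _ - _]card_ord.
apply: leq_trans (card_perm_fix X s0 dis); apply: subset_leq_card.
apply/subsetP => s sinF; rewrite inE; apply/andP; split.
  by move: sinF; rewrite inE => /andP[]; rewrite rot_imset.
by apply/forall_inP => x xA; rewrite (sF s).
Qed.

(* Sets [L] and [L'] drawn at random have the right trace on the at most [2 * T] cells probed
   by a pair with probability at least [2 ^ - (4 * T)]; this is all that is paid for telling the
   decoder which cells are probed. *)
Definition labelled (L L' : {set 'I_S}) s c c' :=
  (L :&: (probed (rot c s) b l :|: probed (rot c' s) b l) == probed (rot c' s) b l) &&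
  (L' :&: (probed (rot c s) b l :|: probed (rot c' s) b l) == probed (rot c s) b l).

(** A code consists of the hybrid memory, [l] indices below [n], the [l] inserted keys in full, and
    [2 * e] optional corrections. What it decodes to leaves few histories by
    [card_fixed_rotations]. *)
Lemma card_labelled_collide (L L' : {set 'I_S}) j c c' : 0 < q ->
  agreement c c' < j ->
  #|[set s | collide s c c' && labelled L L' s c c']| <=
  W ^ S * n ^ l * U ^ l * (S * W).+1 ^ (2 * e) * (n`! * (U - n - (2 * l - j))`!).
Proof.
move=> q_gt0 cj; have lql : l <= q * l by rewrite leq_pmull.
pose I := ({ffun 'I_S -> 'I_W} * l.-tuple 'I_n * l.-tuple 'I_U *
  {ffun 'I_(2 * e) -> option ('I_S * 'I_W)})%type.
have cI : #|{: I}| = W ^ S * n ^ l * U ^ l * (S * W).+1 ^ (2 * e).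
  by rewrite !card_prod !card_ffun !card_tuple card_option card_prod !card_ord.
pose r (x : I) := decode L L' x.1.1.1 [seq val i | i <- x.1.1.2] x.1.2 x.2.
pose F (x : I) := [set s : {perm 'I_U} | [&& rot c s @: slots (b + l) == (r x).1,
  [seq key (rot c s) (p i) | i <- iota b l] == (r x).2
  & [seq key (rot c' s) (n + i) | i <- iota b l] == x.1.2]].
rewrite -cI -sum_nat_const.
apply: (@leq_trans (\sum_x #|F x|)); last first.
  by apply: leq_sum => x _; apply: card_fixed_rotations.
apply: card_le_cover => s; rewrite inE.
move=> /andP[/and3P[/andP[_ g1] /andP[_ g2] /eqP fe] /andP[/eqP eL /eqP eL']].
have blq : b + l + (q * l - l) = b + q * l by lia.
have sz : size [seq key (rot c' s) (n + i) | i <- iota b l] == l by rewrite size_map size_iota.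
have [|||||N [idx [E eN]]] := @decode_complete (2 * e) (rot c s) (rot c' s) b l
    (q * l - l) L L' _ _ _ _ eL eL'.
- by rewrite blq.
- by rewrite !rot_state.
- by rewrite blq => x; have /ffunP/(_ x) := fe; rewrite !ffunE.
- by move=> i iN; rewrite !rot_deleted.
- by rewrite mul2n -addnn leq_add.
exists (N, idx, Tuple sz, E).
have er : r (N, idx, Tuple sz, E) = (rot c s @: slots (b + l),
  [seq key (rot c s) (p i) | i <- iota b l]) := eN.
by rewrite inE er /= !eqxx.
Qed.

Lemma collide_upper j : 0 < q ->
  \sum_s \sum_c \sum_(c' | agreement c c' < j) collide s c c' <=
  2 ^ (4 * T) * ((q ^ l) ^ 2 *
  (W ^ S * n ^ l * U ^ l * (S * W).+1 ^ (2 * e) * (n`! * (U - n - (2 * l - j))`!))).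
Proof.
move=> q_gt0; set B := W ^ S * _ * _ * _ * _.
have cS : #|{set 'I_S}| = 2 ^ S.
  by rewrite -cardsT -powersetT card_powerset cardsT card_ord.
(* Multiplying by the number of pairs [(L, L')] turns the average over labels into a double sum, to
   be exchanged with the sum over histories. *)
rewrite -(@leq_pmul2l (2 ^ S * 2 ^ S)); last by rewrite muln_gt0 !expn_gt0.
have half s c c' (C0 : {set 'I_S}) : collide s c c' ->
    C0 \subset probed (rot c s) b l :|: probed (rot c' s) b l ->
    2 ^ S <= 2 ^ (2 * T) *
      #|[set L : {set 'I_S} | L :&: (probed (rot c s) b l :|: probed (rot c' s) b l) == C0]|.
  move=> /and3P[/andP[g1 _] /andP[g2 _] _] /card_set_trace.
  rewrite card_ord; set C := _ :|: _ => h.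
  apply: leq_trans (leq_mul (leqnn _) h); rewrite -expnD leq_exp2l //.
  have hC : #|C| <= 2 * T.
    by apply: leq_trans (leq_card_setU _ _) _; rewrite mul2n -addnn leq_add.
  have hS : #|C| <= S by apply: leq_trans (max_card _) _; rewrite card_ord.
  by move: #|C| hC hS => x; lia.
have one s c c' : 2 ^ S * 2 ^ S * collide s c c' <=
    2 ^ (4 * T) * \sum_L \sum_L' (collide s c c' && labelled L L' s c c').
  case cl : (collide s c c'); last by rewrite muln0.
  rewrite muln1; have h1 := half s c c' _ cl (subsetUr _ _).
  have h2 := half s c c' _ cl (subsetUl _ _).
  have -> : 2 ^ (4 * T) = 2 ^ (2 * T) * 2 ^ (2 * T) by rewrite -expnD; congr (_ ^ _); lia.
  apply: leq_trans (leq_mul h1 h2) _; rewrite mulnACA leq_mul2l; apply/orP; right.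
  rewrite !card_set_sum big_distrl; apply: leq_sum => L _; rewrite big_distrr.
  by apply: leq_sum => L' _; rewrite /= /labelled mulnb.
rewrite big_distrr; under eq_bigr => s _ do
  (rewrite big_distrr /=; under eq_bigr => c _ do rewrite big_distrr /=).
apply: (@leq_trans (\sum_s \sum_c \sum_(c' | agreement c c' < j)
    2 ^ (4 * T) * \sum_L \sum_L' (collide s c c' && labelled L L' s c c'))).
  by do 3![apply: leq_sum => ? _]; apply: one.
have -> : \sum_s \sum_c \sum_(c' | agreement c c' < j)
    2 ^ (4 * T) * \sum_L \sum_L' (collide s c c' && labelled L L' s c c') =
  2 ^ (4 * T) * \sum_L \sum_L' \sum_c \sum_(c' | agreement c c' < j)
    #|[set s | collide s c c' && labelled L L' s c c']|.
  transitivity (2 ^ (4 * T) * \sum_c \sum_(c' | agreement c c' < j) \sum_L \sum_L'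
      #|[set s | collide s c c' && labelled L L' s c c']|).
    rewrite exchange_big big_distrr; apply: eq_bigr => c _ /=.
    rewrite exchange_big big_distrr; apply: eq_bigr => c' _ /=.
    rewrite -big_distrr; congr (_ * _); rewrite exchange_big; apply: eq_bigr => L _ /=.
    by rewrite exchange_big; apply: eq_bigr => L' _; rewrite card_set_sum.
  congr (_ * _).
  rewrite [RHS](eq_bigr (fun L => \sum_c \sum_(c' | agreement c c' < j) \sum_L'
      #|[set s | collide s c c' && labelled L L' s c c']|)); last first.
    move=> L _; rewrite exchange_big; apply: eq_bigr => c _; exact: exchange_big.
  rewrite exchange_big; apply: eq_bigr => c _; exact: exchange_big.
rewrite mulnCA leq_mul2l; apply/orP; right.
rewrite -[X in _ <= X]mulnA -{1}cS -sum_nat_const; apply: leq_sum => L _.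
rewrite -cS -sum_nat_const; apply: leq_sum => L' _.
rewrite -mulnn -mulnA -card_rotations -sum_nat_const; apply: leq_sum => c _.
rewrite -sum_nat_const [X in X <= _]big_mkcond; apply: leq_sum => c' _.
by case: ifP => // cj; apply: card_labelled_collide.
Qed.

(** The lower and upper bounds on collisions meet here. The size of [q ^ j] ensures that the pairs
    set aside by [collide_split] account for at most half of the collisions. *)
Lemma block_inequality j : 0 < q -> 2 ^ (2 * l + 3) <= q ^ j ->
  U`! <= 2 * #|[set s | good s]| -> W ^ S <= 'C(U, n) * 2 ^ l ->
  (U - n)`! <= 2 ^ (2 * l + 3 + 4 * T) * (n ^ l * U ^ l * (S * W).+1 ^ (2 * e)) *
    (U - n - (2 * l - j))`!.
Proof.
move=> q_gt0 qj hG hV.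
have nU : n <= U by lia.
have bin := bin_fact nU.
have := collide_lower; have := collide_split j q_gt0; have := collide_upper j q_gt0.
set G := #|[set s | good s]| in hG *; set P := \sum_s \sum_c \sum_c' _; set P' := \sum_s _.
set K := (n ^ l * U ^ l * _); set m := (_ - (2 * l - j))`!; set Q := q ^ l.
set f := n`! * (U - n)`! in bin *.
have Q_gt0 : 0 < Q by rewrite expn_gt0 q_gt0.
have F_gt0 : 0 < U`! by rewrite fact_gt0.
set F := U`! in F_gt0 hG bin *; set V := W ^ S in hV *.
move=> hC hB hA.
rewrite -!(mulnA V) -/K in hC.
clearbody G P P' K m V F.
have e2 : 2 ^ (l + 2) = 4 * 2 ^ l by rewrite expnD mulnC.
have e3 : 2 ^ (l + 3) = 8 * 2 ^ l by rewrite expnD mulnC.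
have e4 : 2 ^ (2 * l + 3) = 8 * (2 ^ l * 2 ^ l) by rewrite mul2n -addnn !expnD mulnC.
have e5 : 2 ^ (2 * l + 3 + 4 * T) = 8 * (2 ^ l * 2 ^ l) * 2 ^ (4 * T) by rewrite expnD e4.
(* The density of good histories costs a factor 4, the redundancy a factor [2 ^ l]. *)
have hA' : Q ^ 2 * F <= 2 ^ (l + 2) * P.
  rewrite -(leq_pmul2l F_gt0).
  apply: (@leq_trans (4 * (Q * G) ^ 2)).
    rewrite (_ : F * _ = Q ^ 2 * F ^ 2); last by ring.
    rewrite expnMn (_ : 4 * _ = Q ^ 2 * (2 * G) ^ 2); last by ring.
    by rewrite leq_mul2l leq_sqr hG orbT.
  apply: leq_trans (leq_mul (leqnn 4) hA) _.
  apply: (@leq_trans (4 * ('C(U, n) * 2 ^ l * f * P))).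
    by rewrite leq_mul2l /= leq_mul2r leq_mul2r hV !orbT.
  by rewrite -bin e2; apply: eq_leq; ring.
have hB' : Q ^ 2 * F <= 2 ^ (l + 3) * P'.
  have qj_gt0 : 0 < q ^ j by rewrite expn_gt0 q_gt0.
  have h1 : 2 * (q ^ j * (Q ^ 2 * F)) <= 2 ^ (l + 3) * (q ^ j * P) .
    rewrite (_ : 2 ^ (l + 3) * _ = 2 * (q ^ j * (2 ^ (l + 2) * P))); last first.
      by rewrite e2 e3; ring.
    by rewrite !leq_mul2l hA' !orbT.
  have h2 : 2 ^ (l + 3) * (F * (2 ^ l * Q ^ 2)) <= q ^ j * (Q ^ 2 * F).
    apply: leq_trans (leq_mul qj (leqnn _)).
    by rewrite e3 e4; apply: eq_leq; ring.
  have h3 := leq_mul (leqnn (2 ^ (l + 3))) hB.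
  rewrite -(leq_pmul2l qj_gt0); rewrite mulnDr in h3.
  rewrite (mulnCA (q ^ j) (2 ^ (l + 3))).
  move: (2 ^ (l + 3) * (q ^ j * P)) (2 ^ (l + 3) * (q ^ j * P')) h1 h2 h3 => x y.
  by move: (2 ^ (l + 3) * _) (q ^ j * _) => z t; lia.
have h : Q ^ 2 * F <= Q ^ 2 * ('C(U, n) * n`!) * (2 ^ (2 * l + 3 + 4 * T) * K * m).
  apply: leq_trans hB' _; apply: leq_trans (leq_mul (leqnn _) hC) _.
  apply: (@leq_trans (2 ^ (l + 3) * (2 ^ (4 * T) * (Q ^ 2 *
      ('C(U, n) * 2 ^ l * (K * (n`! * m))))))).
    do 3![rewrite leq_mul2l; apply/orP; right].
    by rewrite leq_mul2r hV orbT.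
  by rewrite e3 e5; apply: eq_leq; ring.
have Cn_gt0 : 0 < 'C(U, n) * n`! by rewrite muln_gt0 bin_gt0 nU fact_gt0.
have Q2_gt0 : 0 < Q ^ 2 by rewrite expn_gt0 Q_gt0.
rewrite -(leq_pmul2l Cn_gt0) -(leq_pmul2l Q2_gt0).
rewrite [X in _ <= X]mulnA; apply: leq_trans h; rewrite -bin /f; apply: eq_leq; ring.
Qed.

End Block.

(** * Choice of a block *)

Definition round_cost s b l := cost (rounds D (steps s b l)) (state s b).

Lemma round_cost_add s b l r :
  round_cost s b (l + r) = round_cost s b l + round_cost s (b + l) r.
Proof. by rewrite /round_cost {1}/steps iotaD map_cat cost_rounds_cat -state_add. Qed.

Lemma probed_add s b l r : probed s b (l + r) = probed s b l :|: probed s (b + l) r.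
Proof. by rewrite /probed {1}/steps iotaD map_cat touched_rounds_cat -state_add. Qed.

Lemma card_probed_pieces s b k t :
  #|probed s b (k * t)| <= \sum_(0 <= i < k) #|probed s (b + i * t) t|.
Proof.
elim: k => [|k IH]; first by rewrite /probed cards0.
rewrite mulSnr probed_add big_nat_recr //=.
by apply: leq_trans (leq_card_setU _ _) _; rewrite leq_add2r.
Qed.

Lemma probed_pieces_cost s b k t :
  \sum_(0 <= i < k) #|probed s (b + i * t) t| <= round_cost s b (k * t).
Proof.
elim: k => [|k IH]; first by rewrite big_geq.
by rewrite big_nat_recr //= mulSnr round_cost_add leq_add //; exact: card_touched.
Qed.

Definition transfer s b q t := #|probed s b t :&: probed s (b + t) (q * t - t)|.

(** Inclusion-exclusion: the right side counts the cells shared by the first child and the others at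
    least twice. *)
Lemma probed_transfer s b q t : 0 < q ->
  #|probed s b (q * t)| + transfer s b q t <=
  \sum_(0 <= i < q) #|probed s (b + i * t) t|.
Proof.
case: q => // q _; rewrite /transfer {1}mulSn probed_add mulSn addKn cardsUI.
rewrite big_nat_recl // mul0n addn0 leq_add2l.
apply: leq_trans (card_probed_pieces _ _ _ _) _.
by apply: leq_sum => i _; rewrite mulSn addnA.
Qed.

Definition total_probed s t k := \sum_(0 <= i < k) #|probed s (i * t) t|.

Lemma total_probed_mul s t k q : total_probed s t (k * q) =
  \sum_(0 <= i < k) \sum_(0 <= r < q) #|probed s (i * (q * t) + r * t) t|.
Proof.
rewrite /total_probed big_nat_mul; apply: eq_bigr => i _.
rewrite -{1}[i * q]add0n big_addn -mulnBl subSnn mul1n.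
by apply: eq_bigr => r _; rewrite mulnDl addnC mulnA.
Qed.

(** Passing to pieces [q] times longer loses at least the transfers, so over successive scales they
    telescope. *)
Lemma total_probed_transfer s t k q : 0 < q ->
  total_probed s (q * t) k + \sum_(0 <= i < k) transfer s (i * (q * t)) q t
    <= total_probed s t (k * q).
Proof.
move=> q_gt0; rewrite total_probed_mul -big_split; apply: leq_sum => i _.
exact: probed_transfer.
Qed.

Lemma first_pieces_total s t k q : 0 < q ->
  \sum_(0 <= i < k) #|probed s (i * (q * t)) t| <= total_probed s t (k * q).
Proof.
case: q => // q _; rewrite total_probed_mul; apply: leq_sum => i _.
by rewrite big_nat_recl // mul0n addn0 leq_addr.
Qed.

(* A probe is charged to the unique scale at which it links the first child of a block
   to the other children. *)
Lemma transfers_le_cost s q l J : 0 < q ->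
  \sum_(0 <= j < J) \sum_(0 <= i < q ^ (J - j.+1))
     transfer s (i * (q * (q ^ j * l))) q (q ^ j * l) <= round_cost s 0 (q ^ J * l).
Proof.
move=> q_gt0; apply: leq_trans (probed_pieces_cost s 0 (q ^ J) l).
under [X in _ <= X]eq_bigr => i _ do rewrite add0n.
rewrite -/(total_probed s l (q ^ J)).
suff h k : k <= J -> total_probed s (q ^ k * l) (q ^ (J - k)) +
    \sum_(0 <= j < k) \sum_(0 <= i < q ^ (J - j.+1))
     transfer s (i * (q * (q ^ j * l))) q (q ^ j * l) <= total_probed s l (q ^ J).
  by apply: leq_trans (h J (leqnn J)); rewrite leq_addl.
elim: k => [|k IH] kJ; first by rewrite big_geq // addn0 mul1n subn0.
rewrite big_nat_recr //= expnS -mulnA [X in _ + X]addnC addnA.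
apply: leq_trans (IH (ltnW kJ)); rewrite leq_add2r.
have -> : q ^ (J - k) = q ^ (J - k.+1) * q by rewrite -expnSr; congr (_ ^ _); lia.
exact: total_probed_transfer.
Qed.

Lemma total_probed_cost s q l J j : 0 < q -> j <= J ->
  total_probed s (q ^ j * l) (q ^ (J - j)) <= round_cost s 0 (q ^ J * l).
Proof.
move=> q_gt0 jJ; have := probed_pieces_cost s 0 (q ^ (J - j)) (q ^ j * l).
by rewrite mulnA -expnD subnK.
Qed.

(** If every block failed, summing over one scale and removing its first-piece probes, at most
    [Gam], would leave transfers above [Gam / J] at each of the [J] scales. All transfers together
    are at most [Gam]. *)
Lemma block_selection q l J :
  let Gam := \sum_s round_cost s 0 (q ^ J * l) in
  0 < q -> 0 < J -> exists j i, [/\ j < J, i < q ^ (J - j.+1) &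
    q ^ (J - j.+1) *
    (J * (\sum_s transfer s (i * (q * (q ^ j * l))) q (q ^ j * l)) +
      \sum_s #|probed s (i * (q * (q ^ j * l))) (q ^ j * l)|) <= 2 * Gam].
Proof.
move=> Gam q_gt0 J_gt0.
pose B j i := \sum_s transfer s (i * (q * (q ^ j * l))) q (q ^ j * l).
pose A j i := \sum_s #|probed s (i * (q * (q ^ j * l))) (q ^ j * l)|.
case: (boolP [exists j : 'I_J, exists i : 'I_(q ^ (J - j.+1)),
    q ^ (J - j.+1) * (J * B j i + A j i) <= 2 * Gam]) => [/existsP[j /existsP[i h]]|].
  by exists j, i.
rewrite negb_exists => /forallP h.
have sumA j : j < J -> \sum_(0 <= i < q ^ (J - j.+1)) A j i <= Gam.
  move=> jJ; rewrite exchange_big; apply: leq_sum => s _.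
  apply: leq_trans (total_probed_cost s l q_gt0 (ltnW jJ)).
  have -> : q ^ (J - j) = q ^ (J - j.+1) * q by rewrite -expnSr; congr (_ ^ _); lia.
  exact: first_pieces_total.
have sumB : \sum_(0 <= j < J) \sum_(0 <= i < q ^ (J - j.+1)) B j i <= Gam.
  rewrite (eq_bigr (fun j => \sum_s \sum_(0 <= i < q ^ (J - j.+1))
     transfer s (i * (q * (q ^ j * l))) q (q ^ j * l))); last first.
    by move=> j _; exact: exchange_big.
  by rewrite exchange_big; apply: leq_sum => s _; apply: transfers_le_cost.
have big j : j < J -> Gam < J * \sum_(0 <= i < q ^ (J - j.+1)) B j i.
  move=> jJ; have := h (Ordinal jJ); rewrite negb_exists => /forallP hi /=.
  set X := q ^ (J - j.+1) in hi *.
  have X_gt0 : 0 < X by rewrite expn_gt0 q_gt0.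
  have : \sum_(0 <= i < X) (2 * Gam).+1 <= \sum_(0 <= i < X) X * (J * B j i + A j i).
    rewrite !big_mkord; apply: leq_sum => i _.
    by have := hi i; rewrite -ltnNge.
  rewrite sum_nat_const_nat subn0 -big_distrr leq_pmul2l // big_split -big_distrr /=.
  by have := sumA j jJ; rewrite -/X; lia.
have : \sum_(0 <= j < J) Gam.+1 <=
    \sum_(0 <= j < J) J * \sum_(0 <= i < q ^ (J - j.+1)) B j i.
  by rewrite !big_nat; apply: leq_sum => j /andP[_]; apply: big.
rewrite sum_nat_const_nat subn0 -big_distrr /= leq_pmul2l //.
by rewrite ltnNge sumB.
Qed.

(** Markov's inequality without division. The failure probability is at most a quarter, so two such
    events leave half of the histories. *)
Lemma markov_card (f : {perm 'I_U} -> nat) T X V :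
  8 * V < T.+1 * X * U`! -> X * (\sum_s f s) <= 2 * V ->
  4 * #|[set s | T < f s]| <= U`!.
Proof.
move=> h1 h2; have h3 : T.+1 * #|[set s | T < f s]| <= \sum_s f s.
  rewrite mulnC -sum_nat_const [X in X <= _]big_mkcond; apply: leq_sum => s _.
  by rewrite inE; case: ifP.
have h4 := leq_mul (leqnn (4 * X)) h3.
have h5 := leq_mul (leqnn 4) h2.
have : T.+1 * X * (4 * #|[set s | T < f s]|) < T.+1 * X * U`!.
  apply: leq_ltn_trans h1.
  rewrite (_ : T.+1 * X * _ = 4 * X * (T.+1 * #|[set s | T < f s]|)); last by ring.
  by apply: leq_trans h4 _; rewrite -mulnA; apply: leq_trans h5 _; rewrite mulnA.
by rewrite ltn_mul2l => /andP[_] /ltnW.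
Qed.

Lemma good_block q l0 J :
  let Gam := \sum_s round_cost s 0 n in
  0 < q -> 0 < J -> 0 < l0 -> q ^ J * l0 <= n ->
  exists b l T e, [/\ l0 <= l, b + q * l <= n, U`! <= 2 * #|[set s | good b l q T e s]|,
    T * (q ^ J * l0) * U`! <= 8 * Gam * (q * l) &
    e * J * (q ^ J * l0) * U`! <= 8 * Gam * (q * l)].
Proof.
move=> Gam q_gt0 J_gt0 l0_gt0 hn.
have [j [i [jJ iX h]]] := block_selection l0 q_gt0 J_gt0.
set X := q ^ (J - j.+1) in h iX; set l := q ^ j * l0 in h.
set Gam' := \sum_s round_cost s 0 (q ^ J * l0) in h.
have GG : Gam' <= Gam.
  apply: leq_sum => s _; have := round_cost_add s 0 (q ^ J * l0) (n - q ^ J * l0).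
  by rewrite subnKC // => ->; exact: leq_addr.
have eX : X * (q * l) = q ^ J * l0.
  by rewrite !mulnA -expnSr -expnD; congr (_ ^ _ * _); lia.
have X_gt0 : 0 < X by rewrite expn_gt0 q_gt0.
have F_gt0 := fact_gt0 U.
(* Rounding down keeps the products below [8 * Gam], while the successor in [markov_card] makes up
   for it. *)
pose T := (8 * Gam) %/ (X * U`!); pose e := (8 * Gam) %/ (X * J * U`!).
exists (i * (q * l)), l, T, e; split.
- by rewrite leq_pmull // expn_gt0 q_gt0.
- by rewrite -mulSnr (leq_trans _ hn) // -eX leq_mul2r iX orbT.
- set A := fun s => #|probed s (i * (q * l)) l|.
  set B := fun s => transfer s (i * (q * l)) q l.
  have h1 : 4 * #|[set s | T < A s]| <= U`!.
    apply: (@markov_card _ _ X Gam); first by rewrite -mulnA ltn_ceil // muln_gt0 X_gt0.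
    apply: leq_trans (leq_mul (leqnn 2) GG); apply: leq_trans h.
    by rewrite leq_mul2l leq_addl orbT.
  have h2 : 4 * #|[set s | e < B s]| <= U`!.
    apply: (@markov_card _ _ (X * J) Gam).
      by rewrite -mulnA ltn_ceil // !muln_gt0 X_gt0 J_gt0.
    apply: leq_trans (leq_mul (leqnn 2) GG); apply: leq_trans h.
    by rewrite -mulnA leq_mul2l leq_addr orbT.
  have : #|~: [set s | good (i * (q * l)) l q T e s]| <=
      #|[set s | T < A s]| + #|[set s | e < B s]|.
    apply: leq_trans (leq_card_setU _ _); apply: subset_leq_card; apply/subsetP => s.
    by rewrite !inE /good negb_and -!ltnNge.
  have := cardsC [set s | good (i * (q * l)) l q T e s]; rewrite card_Sn.
  lia.
- rewrite -eX (_ : T * _ * _ = T * (X * U`!) * (q * l)); last by ring.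
  by rewrite leq_mul2r leq_trunc_div orbT.
- rewrite -eX (_ : e * _ * _ * _ = e * (X * J * U`!) * (q * l)); last by ring.
  by rewrite leq_mul2r leq_trunc_div orbT.
Qed.

Lemma cell_probe_tradeoff q l0 J :
  let Gam := \sum_s round_cost s 0 n in
  0 < q -> 0 < J -> 0 < l0 -> q ^ J * l0 <= n -> W ^ S <= 'C(U, n) * 2 ^ l0 ->
  exists l T e, [/\ l0 <= l, q * l <= n,
    T * (q ^ J * l0) * U`! <= 8 * Gam * (q * l),
    e * J * (q ^ J * l0) * U`! <= 8 * Gam * (q * l) &
    forall j, 2 ^ (2 * l + 3) <= q ^ j ->
    (U - n)`! <= 2 ^ (2 * l + 3 + 4 * T) * (n ^ l * U ^ l * (S * W).+1 ^ (2 * e)) *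
      (U - n - (2 * l - j))`!].
Proof.
move=> Gam q_gt0 J_gt0 l0_gt0 hn hV.
have [b [l [T [e [ll bq hG hT he]]]]] := good_block q_gt0 J_gt0 l0_gt0 hn.
exists l, T, e; split=> // [|j qj]; first by apply: leq_trans bq; apply: leq_addl.
apply: (@block_inequality b l q _ bq T e j) => //; first by apply: leq_trans ll.
apply: leq_trans hV _; rewrite leq_mul2l leq_exp2l // ll; exact: orbT.
Qed.

End World.

(** * Averages over histories *)

Import Order.TTheory GRing.Theory Num.Theory.
Local Open Scope ring_scope.

Section Averages.
Variable R : realType.
Implicit Types (T I : finType).

Lemma eq_avg T (A B : {set T}) (f g : T -> R) :
  A = B -> {in A, f =1 g} -> avg A f = avg B g.
Proof. by move=> <- fg; rewrite /avg; congr (_ / _); apply: eq_bigr. Qed.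

Lemma ler_avg T (A : {set T}) (f g : T -> R) :
  {in A, forall x, f x <= g x} -> avg A f <= avg A g.
Proof. by move=> fg; rewrite /avg ler_wpM2r ?invr_ge0 ?ler0n //; apply: ler_sum. Qed.

Lemma avg_cst T (A : {set T}) (c : R) : A != set0 -> avg A (fun=> c) = c.
Proof.
rewrite -card_gt0 => A0; rewrite /avg sumr_const -[c *+ _]mulr_natr mulfK //.
by rewrite pnatr_eq0 -lt0n.
Qed.

Lemma avg_ge T (A : {set T}) (f : T -> R) c : A != set0 ->
  {in A, forall x, c <= f x} -> c <= avg A f.
Proof. by move=> A0 h; rewrite -[leLHS](avg_cst c A0); apply: ler_avg. Qed.

Lemma avg_ge0 T (A : {set T}) (f : T -> R) :
  {in A, forall x, 0 <= f x} -> 0 <= avg A f.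
Proof. by move=> h; rewrite /avg divr_ge0 ?ler0n // sumr_ge0. Qed.

Lemma avgD T (A : {set T}) (f g : T -> R) :
  avg A (fun x => f x + g x) = avg A f + avg A g.
Proof. by rewrite /avg big_split mulrDl. Qed.

Lemma avg2_addl T I (A : {set T}) (B : {set I}) c (F : T -> I -> R) :
  A != set0 -> B != set0 ->
  avg A (fun x => avg B (fun y => c + F x y)) = c + avg A (fun x => avg B (F x)).
Proof.
move=> A0 B0; rewrite -[c in RHS](avg_cst c A0) -avgD.
by apply: eq_avg => // x _; rewrite avgD avg_cst.
Qed.

Lemma avg_exchange T I (A : {set T}) (B : {set I}) (f : T -> I -> R) :
  avg A (fun x => avg B (f x)) = avg B (fun y => avg A (f^~ y)).
Proof.
rewrite /avg -2!big_distrl /= exchange_big /= -!mulrA; congr (_ * _).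
exact: mulrC.
Qed.

Lemma avg_imset T I (A : {set T}) (h : T -> I) (f : I -> R) :
  injective h -> avg (h @: A) f = avg A (f \o h).
Proof.
by move=> hi; rewrite /avg card_imset // big_imset //= => x y _ _; apply: hi.
Qed.

(** Law of total expectation when all fibers have the same size. *)
Lemma avg_fiber T I (A : {set T}) (B : {set I}) (g : T -> I) N (f : T -> R) :
  (0 < N)%N -> {in A, forall x, g x \in B} ->
  {in B, forall y, #|[set x in A | g x == y]| = N} ->
  avg A f = avg B (fun y => avg [set x in A | g x == y] f).
Proof.
move=> N0 gB hN.
have part (F : T -> R) : \sum_(x in A) F x =
    \sum_(y in B) \sum_(x in [set x in A | g x == y]) F x.
  rewrite (partition_big g (fun y => y \in B)) //=.
  by apply: eq_bigr => y _; apply: eq_bigl => x; rewrite inE.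
have cA : #|A|%:R = N%:R * #|B|%:R :> R.
  rewrite -sum1_card natr_sum part.
  under eq_bigr => y yB do rewrite -natr_sum sum1_card hN //.
  by rewrite sumr_const -[LHS]mulr_natr.
rewrite /avg cA part invfM mulrA; congr (_ * _).
rewrite big_distrl; apply: eq_bigr => y yB. by rewrite hN.
Qed.

End Averages.

(** * Uniform permutations drawn value by value *)

Section PermutationPrefix.
Variables (U : nat) (u0 : 'I_U).
Implicit Types (s t : {perm 'I_U}) (V : {set 'I_U}).
Local Open Scope nat_scope.

Lemma at_val (x : 'I_U) : at_ u0 x = x.
Proof. by apply: ord_inj; rewrite val_at. Qed.

Definition prefix_values k s := s @: [set x : 'I_U | x < k].

Lemma mem_prefix_values k s x : (s x \in prefix_values k s) = (x < k).
Proof. by rewrite mem_imset ?inE //; apply: perm_inj. Qed.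

Definition same_prefix k s t := [forall x : 'I_U, (x < k) ==> (s x == t x)].

(** The conditional probability space once the first [k] values are drawn. *)
Definition prefix_class V k t := [set s | perm_on V s && same_prefix k s t].

Lemma same_prefixP k s t :
  reflect (forall x : 'I_U, x < k -> s x = t x) (same_prefix k s t).
Proof. by apply: (iffP 'forall_implyP) => h x /h; [move/eqP|move->]. Qed.

Lemma prefix_class_same V k s t x : s \in prefix_class V k t -> x < k -> x < U ->
  s (at_ u0 x) = t (at_ u0 x).
Proof. by rewrite inE => /andP[_ /same_prefixP h] xk xU; apply: h; rewrite val_at. Qed.

Lemma prefix_valuesS k s : k < U ->
  prefix_values k.+1 s = s (at_ u0 k) |: prefix_values k s.
Proof.
move=> kU; rewrite /prefix_values -imsetU1.
suff -> : [set x : 'I_U | x < k.+1] = at_ u0 k |: [set x : 'I_U | x < k] by [].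
by apply/setP => x; rewrite !inE -val_eqE /= val_at // ltnS leq_eqVlt.
Qed.

Lemma eq_prefix_values k s t : same_prefix k s t -> prefix_values k s = prefix_values k t.
Proof. by move/same_prefixP => h; apply: eq_in_imset => x; rewrite inE; apply: h. Qed.

Definition extend t k x : {perm 'I_U} := (t * tperm (t (at_ u0 k)) x)%g.

Lemma extend_at t k x : extend t k x (at_ u0 k) = x.
Proof. by rewrite permM tpermL. Qed.

Lemma extend_same t k x : k < U -> x \notin prefix_values k t ->
  same_prefix k (extend t k x) t.
Proof.
move=> kU xk; apply/same_prefixP => y yk; rewrite permM tpermD //.
  by rewrite (inj_eq perm_inj) -val_eqE /= val_at //; lia.
by apply: contraNneq xk => ->; rewrite mem_prefix_values.
Qed.

Lemma extend_on V t k x : perm_on V t -> at_ u0 k \in V -> x \in V ->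
  perm_on V (extend t k x).
Proof.
move=> tV kV xV; apply: perm_onM => //; apply/subsetP => y; rewrite inE.
by case: tpermP => [->|->|]; rewrite ?(perm_closed _ tV) ?eqxx.
Qed.

Lemma prefix_class_nonempty V k t : perm_on V t -> t \in prefix_class V k t.
Proof. by move=> tV; rewrite inE tV; apply/same_prefixP. Qed.

Lemma card_prefix_class V k t : perm_on V t ->
  #|prefix_class V k t| = #|prefix_class V k 1%g|.
Proof.
move=> tV; rewrite -[RHS](card_imset _ (mulIg t)); apply: eq_card => s.
apply/idP/imsetP => [|[r]].
  rewrite inE => /andP[sV /same_prefixP h]; exists (s * t^-1)%g; last by rewrite mulgKV.
  rewrite inE perm_onM ?perm_onV //=; apply/same_prefixP => x xk.
  by rewrite permM h // permK perm1.
rewrite !inE => /andP[rV /same_prefixP h] ->; rewrite perm_onM //=.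
by apply/same_prefixP => x xk; rewrite permM h // perm1.
Qed.

Lemma prefix_class_fiber V k t x : k < U -> perm_on V t ->
  x \notin prefix_values k t ->
  [set s in prefix_class V k t | s (at_ u0 k) == x] = prefix_class V k.+1 (extend t k x).
Proof.
move=> kU tV xk; apply/setP => s; rewrite !inE -andbA; congr andb.
have /same_prefixP hx := extend_same kU xk.
apply/andP/same_prefixP => [[/same_prefixP h /eqP hs] y|h].
  rewrite ltnS leq_eqVlt => /orP[/eqP yk|yk]; last by rewrite hx // h.
  by have -> : y = at_ u0 k; [apply: ord_inj; rewrite val_at|rewrite hs extend_at].
split; last by rewrite h ?extend_at // val_at.
by apply/same_prefixP => y yk; rewrite -hx // h // ltnW.
Qed.

Lemma avg_extend (R : realType) V k t (F : {perm 'I_U} -> R) :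
  k < U -> at_ u0 k \in V -> perm_on V t ->
  avg (prefix_class V k t) F =
  avg (V :\: prefix_values k t) (fun x => avg (prefix_class V k.+1 (extend t k x)) F).
Proof.
move=> kU kV tV.
rewrite (@avg_fiber _ _ _ _ (V :\: prefix_values k t) (fun s => s (at_ u0 k))
  #|prefix_class V k.+1 1%g|).
- apply: eq_avg => // x; rewrite inE => /andP[xk xV].
  by apply: eq_avg => //; apply: prefix_class_fiber.
- by apply/card_gt0P; exists 1%g; apply: prefix_class_nonempty; apply: perm_on1.
- move=> s; rewrite !inE => /andP[sV sk]; rewrite (perm_closed _ sV) kV andbT.
  by rewrite -(eq_prefix_values sk) mem_prefix_values val_at // ltnn.
- move=> x; rewrite inE => /andP[xk xV]; rewrite prefix_class_fiber //.
  by apply: card_prefix_class; apply: extend_on.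
Qed.

End PermutationPrefix.

(** * The hard distribution as a pair of permutations *)

Section HardDistribution.
Variables (R : realType) (U S W n : nat) (D : dict U S W) (u0 : 'I_U).
Hypothesis n2U : (2 * n <= U)%N.
Implicit Types (s t : {perm 'I_U}) (m : mem S W).

Definition low : {set 'I_U} := [set x : 'I_U | (x < n)%N].

(* Deletion orders are permutations of all keys supported on the positions below [n], so that
   the same lemmas on prefixes serve for both components of a history. *)
Definition order_of t (j : nat) : nat := t (at_ u0 j).

Lemma perm_onT s : perm_on setT s.
Proof. by apply/subsetP => x _; rewrite inE. Qed.

(** Induction on the rounds left: drawing [d] extends the deletion order [t] by one value, drawing
    [a] extends the list of keys [s] by one. *)
Lemma phase2E i j m s t : (i + j = n)%N -> perm_on low t ->
  phase2 R D i m (prefix_values n s) (s @: (low :\: prefix_values j t))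
    (s @: (low :\: prefix_values j t) :|: (prefix_values (n + j) s :\: prefix_values n s)) =
  avg (prefix_class setT (n + j) s) (fun s' => avg (prefix_class low j t) (fun t' =>
    (cost (rounds D (steps n u0 (order_of t') s' j i)) m)%:R)).
Proof.
elim: i j m s t => [|i IH] j m s t ij tl /=.
  rewrite -[LHS](@avg_cst _ _ (prefix_class setT (n + j) s)); last first.
    by apply/set0Pn; exists s; apply: (prefix_class_nonempty _ (perm_onT s)).
  apply: eq_avg => // s' _; rewrite avg_cst //.
  by apply/set0Pn; exists t; apply: prefix_class_nonempty.
have sT r : perm_on setT r := perm_onT r.
have jU : (j < U)%N by lia.
have njU : (n + j < U)%N by lia.
have s_low x : (s x \in prefix_values n s) = (x \in low).
  by rewrite mem_prefix_values inE.
rewrite (avg_imset _ _ (@perm_inj _ s)) avg_exchange (avg_extend (u0 := u0)) //; last first.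
  by rewrite inE val_at //; lia.
apply: eq_avg => // x; rewrite inE => /andP[xj xl] /=.
set d := s x; set t1 := extend u0 t j x.
have t1l : perm_on low t1 by apply: extend_on => //; rewrite inE val_at; lia.
rewrite avg_exchange (avg_extend (u0 := u0)) ?inE //.
set Rm := s @: _; set X := Rm :|: _.
(* Only initial keys are ever deleted, so this union is the set of all keys used so far, exactly
   what the next value of [s] must avoid. *)
have KX : prefix_values n s :|: X :\ d = prefix_values (n + j) s.
  apply/setP => y; rewrite !inE.
  have [yn|yn] := boolP (y \in prefix_values n s).
    move: yn => /imsetP[z]; rewrite inE => zn ->.
    by rewrite !mem_prefix_values ?zn (leq_trans zn) ?leq_addr.
  have -> : (y \in Rm) = false.
    apply: contraNF yn => /imsetP[z]; rewrite inE => /andP[_ zl] ->.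
    by rewrite s_low.
  rewrite (_ : y != d) //=; apply: contraNneq yn => ->.
  by rewrite s_low.
rewrite -setTD KX; apply: eq_avg => // a; rewrite inE => /andP[aj _].
set s1 := extend u0 s (n + j) a.
have s1s : same_prefix (n + j) s1 s by apply: extend_same.
have t1t : same_prefix j t1 t by apply: extend_same.
have s1n : same_prefix n s1 s.
  by apply/same_prefixP => y yn; move/same_prefixP: s1s; apply; apply: ltn_addr.
have pn : prefix_values n s1 = prefix_values n s by apply: eq_prefix_values.
have pt : prefix_values j.+1 t1 = x |: prefix_values j t.
  by rewrite (prefix_valuesS u0) // extend_at (eq_prefix_values t1t).
have ps : prefix_values (n + j.+1) s1 = a |: prefix_values (n + j) s.
  by rewrite addnS (prefix_valuesS u0) // extend_at (eq_prefix_values s1s).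
have an : a \notin prefix_values n s.
  apply: contraNN aj => /imsetP[z]; rewrite inE => zn ->.
  by rewrite !mem_prefix_values ?zn (leq_trans zn) ?leq_addr.
have eR : s1 @: (low :\: prefix_values j.+1 t1) = Rm :\ d.
  rewrite pt (_ : s1 @: _ = s @: (low :\: (x |: prefix_values j t))); last first.
    apply: eq_in_imset => y; rewrite inE => /andP[_]; rewrite inE => yn.
    by move/same_prefixP: s1n; apply.
  have RmE z : (s z \in Rm) = (z \notin prefix_values j t) && (z \in low).
    by rewrite mem_imset ?in_setD //; apply: perm_inj.
  apply/setP => y; rewrite -(permKV s y) in_setD1 RmE mem_imset; last exact: perm_inj.
  by rewrite in_setD in_setU1 (inj_eq perm_inj) negb_or andbA.
have eX : Rm :\ d :|: (prefix_values (n + j.+1) s1 :\: prefix_values n s) = a |: X :\ d.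
  rewrite ps; apply/setP => y; rewrite !inE.
  have [->|ya] /= := eqVneq y a; first by rewrite an orbT.
  have [->|yd] //= := eqVneq y d; by rewrite s_low xl.
have key1 s' : s' \in prefix_class setT (n + j).+1 s1 -> forall t',
  t' \in prefix_class low j.+1 t1 -> step n u0 (order_of t') s' j = (d, a).
  move=> s'1 t' t'1; rewrite /step /key /order_of at_val.
  rewrite (prefix_class_same u0 t'1) // extend_at (prefix_class_same u0 s'1) // extend_at.
  congr (_, _); move: s'1; rewrite inE => /andP[_ /same_prefixP h].
  move: xl; rewrite inE => xn; rewrite h; last by lia.
  by move/same_prefixP: s1n; apply.
transitivity (avg (prefix_class setT (n + j).+1 s1) (fun s' => avg (prefix_class low j.+1 t1)
  (fun t' => (cost (round D (d, a)) m)%:R +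
    (cost (rounds D (steps n u0 (order_of t') s' j.+1 i)) (post (round D (d, a)) m))%:R : R))).
  rewrite avg2_addl; last 2 first.
  - by apply/set0Pn; exists s1; apply: prefix_class_nonempty.
  - by apply/set0Pn; exists t1; apply: prefix_class_nonempty.
  congr (_ + _); first by rewrite !cost_andthen /= addnA.
  rewrite -addnS -IH ?pn ?eR ?eX //; last by lia.
  by rewrite !post_andthen.
apply: eq_avg => // s' s'1; apply: eq_avg => // t' t'1.
by rewrite -natrD -cost_andthen -(key1 s' s'1 t' t'1).
Qed.

(** Only an inequality, as the probes of the initial insertions are dropped. *)
Lemma phase1_ge k i m s : (i + k = n)%N ->
  avg (prefix_class setT k s) (fun s' => avg (prefix_class low 0 1%g) (fun t =>
    (cost (rounds D (steps n u0 (order_of t) s' 0 n))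
      (post (inserts D [seq key u0 s' x | x <- iota k i]) m))%:R)) <=
  phase1 R D n i m (prefix_values k s).
Proof.
elim: i k m s => [|i IH] k m s ik /=.
  have V0 : low :\: prefix_values 0 1 = low.
    by apply/setP => x; rewrite inE -{1}[x]perm1 mem_prefix_values.
  have Ks : s @: low = prefix_values n s by [].
  have := phase2E m s (addn0 n) (perm_on1 low); rewrite V0 Ks addn0 setDv setU0.
  by rewrite -ik => ->.
have kU : (k < U)%N by lia.
rewrite (avg_extend (u0 := u0)) ?inE ?perm_onT // -setTD.
apply: ler_avg => x; rewrite inE => /andP[xk _].
set s1 := extend u0 s k x.
have s1s : same_prefix k s1 s by apply: extend_same.
have ps : prefix_values k.+1 s1 = x |: prefix_values k s.
  by rewrite (prefix_valuesS u0) // extend_at (eq_prefix_values s1s).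
rewrite -ps; have ik1 : (i + k.+1 = n)%N by lia.
apply: le_trans (le_trans (IH k.+1 (post (d_ins D x) m) s1 ik1) _).
  apply: ler_avg => s' s'1; apply: ler_avg => t _.
  have -> : key u0 s' k = x by rewrite /key (prefix_class_same u0 s'1) // extend_at.
  by rewrite post_andthen.
by rewrite lerDr ler0n.
Qed.

(** Some deletion order costs at most the average; once it is fixed, only [s] remains random. *)
Lemma hard_expected_cost_ge : exists2 t, perm_on low t &
  (\sum_s round_cost n D u0 (order_of t) s 0 n)%:R <=
  U`!%:R * hard_expected_cost R n D.
Proof.
have A0 : prefix_class low 0 (1%g : {perm 'I_U}) != set0.
  by apply/set0Pn; exists 1%g; apply/prefix_class_nonempty/perm_on1.
have F0 : 0 < U`!%:R :> R by rewrite ltr0n fact_gt0.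
have /existsP[t /andP[tl ht]] : [exists t, perm_on low t &&
    ((\sum_s round_cost n D u0 (order_of t) s 0 n)%:R <=
      U`!%:R * hard_expected_cost R n D)].
  apply: contraT; rewrite negb_exists => /forallP h.
  have := phase1_ge (d_init D) 1 (addn0 n).
  have -> : prefix_values 0 (1%g : {perm 'I_U}) = set0.
    by apply/setP => x; rewrite -{1}[x]perm1 mem_prefix_values inE.
  have -> : prefix_class setT 0 1 = [set: {perm 'I_U}].
    by apply/setP => s; rewrite !inE perm_onT; apply/same_prefixP.
  rewrite avg_exchange -/(hard_expected_cost R n D) leNgt => /negP[].
  rewrite {1}/avg ltr_pdivlMr ?ltr0n ?card_gt0 // mulr_natr -sumr_const.
  apply: ltr_sum => [|t].
    by apply/hasP; exists 1%g; rewrite ?mem_index_enum // inE perm_on1; apply/same_prefixP.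
  rewrite inE => /andP[tl _]; have := h t; rewrite tl /= -ltNge => ht.
  rewrite /avg cardsT card_Sn ltr_pdivlMr // mulrC; apply: lt_le_trans ht _.
  by rewrite natr_sum le_eqVlt; apply/orP; left; apply/eqP/eq_bigl => s; rewrite inE.
by exists t.
Qed.

End HardDistribution.

(** * Number of memories, and one probe per insertion *)

Section Capacity.
Variables (U S W n : nat) (D : dict U S W).
Hypothesis D_correct : correct_dict n D.
Local Open Scope nat_scope.

Lemma contents_onto (X : {set 'I_U}) : #|X| <= n ->
  exists f : {ffun 'I_S -> 'I_W}, contents D f = X.
Proof.
move=> cX; have l0 : legit n D (d_init D) set0 by exact: D_correct.
have hX : legit n D (post (inserts D (enum X)) (d_init D)) X.
  have -> : X = set0 :|: [set x in enum X].
    by apply/setP => x; rewrite !inE mem_enum.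
  rewrite (_ : enum (set0 :|: _) = enum X); last first.
    by apply: eq_enum => x; rewrite !inE mem_enum.
  apply: legit_inserts => //; first exact: enum_uniq.
    by apply/allP => x; rewrite inE.
  by rewrite cards0 -cardE.
exists [ffun c => post (inserts D (enum X)) (d_init D) c].
rewrite -[RHS](legit_contents hX); by apply: eq_contents => c; rewrite ffunE.
Qed.

(** Sets of [n - 1] keys need memories of their own; this keeps the redundancy away from 0. *)
Lemma capacity : 0 < n -> 'C(U, n) + 'C(U, n.-1) <= W ^ S.
Proof.
move=> n_gt0.
have cU k : 'C(U, k) = #|[set X : {set 'I_U} | #|X| == k]|.
  by rewrite card_draws card_ord.
rewrite !cU.
set A := [set X : {set 'I_U} | #|X| == n]; set B := [set X : {set 'I_U} | #|X| == n.-1].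
have -> : #|A| + #|B| = #|A :|: B|.
  rewrite cardsU (_ : A :&: B = set0) ?cards0 ?subn0 //.
  by apply/setP => X; rewrite !inE; apply/negP => /andP[/eqP -> /eqP]; lia.
have -> : W ^ S = #|[set: {ffun 'I_S -> 'I_W}]| by rewrite cardsT card_ffun !card_ord.
apply: leq_trans (leq_imset_card (fun f : {ffun 'I_S -> 'I_W} => contents D f) _).
apply/subset_leq_card/subsetP => X XAB.
have [|f <-] := @contents_onto X; last exact: imset_f.
by move: XAB; rewrite !inE => /orP[] /eqP ->; lia.
Qed.

(** From [n 'C(U, n) = (U - n + 1) 'C(U, n - 1)], the second term of [capacity] is at least
    ['C(U, n) / U]. *)
Lemma capacityM : 0 < n -> n <= U -> U.+1 * 'C(U, n) <= U * W ^ S.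
Proof.
move=> n_gt0 nU; apply: (@leq_trans (U * ('C(U, n) + 'C(U, n.-1)))); last first.
  by rewrite leq_mul2l capacity // orbT.
rewrite mulSn mulnDr addnC leq_add2l; have := mul_bin_left U n.-1; rewrite prednK // => e.
apply: (@leq_trans (n * 'C(U, n))); first by rewrite leq_pmull.
by rewrite e leq_mul2r; apply/orP; right; lia.
Qed.

Lemma phase2_ge0 (R : realType) i m (K Rm X : {set 'I_U}) :
  (0 <= phase2 R D i m K Rm X)%R.
Proof.
elim: i m K Rm X => [|i IH] m K Rm X /=; first exact: lexx.
apply: avg_ge0 => d _; apply: avg_ge0 => a _; exact: addr_ge0.
Qed.

(** An insertion changes the contents, hence costs a probe. This constant bound serves when
    [log (n / R)] is bounded. *)
Lemma phase1_ge_inserts (R : realType) i m (X : {set 'I_U}) :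
  legit n D m X -> #|X| + i <= n -> n <= U -> (i%:R <= phase1 R D n i m X)%R.
Proof.
elim: i m X => [|i IH] m X mX cX nU /=; first exact: phase2_ge0.
have XU : ~: X != set0.
  rewrite -card_gt0; have := cardsC X; rewrite card_ord.
  by move: cX; move: #|X| #|~: X| => x y; lia.
apply: avg_ge => // x; rewrite inE => xX; rewrite -natr1 addrC lerD //.
  rewrite (ler_nat R 1); apply: (cost_ins_gt0 mX xX).
  by apply: leq_trans cX; rewrite addnS ltnS leq_addr.
apply: IH => //; last by rewrite cardsU1 xX add1n addSnnS.
by apply: legit_ins => //; apply: leq_trans cX; rewrite addnS ltnS leq_addr.
Qed.

Lemma hard_expected_cost_ge_n (R : realType) : n <= U ->
  (n%:R <= hard_expected_cost R n D)%R.
Proof. by move=> nU; apply: phase1_ge_inserts; rewrite ?cards0. Qed.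

End Capacity.

(** * Integer inequalities *)

Section Arithmetic.
Local Open Scope nat_scope.

Lemma leq_expn m n r : m <= n -> m ^ r <= n ^ r.
Proof. by case: r => // r mn; rewrite leq_exp2r. Qed.

Lemma leq_exp_fact x r : r <= x -> (x - r) ^ r * (x - r)`! <= x`!.
Proof.
elim: r => [|r IH] rx; first by rewrite subn0 mul1n.
apply: leq_trans (IH (ltnW rx)); have -> : x - r = (x - r.+1).+1 by lia.
rewrite factS expnSr -mulnA leq_mul //; first exact: leq_expn.
by rewrite leq_mul2r leqnSn orbT.
Qed.

(** For [r = 2 * l - j] the quotient of factorials is at least [(U - n - r) ^ r], hence at least
    [(U / 2) ^ r] since [n + r <= 3 * n]. Cancelling [U ^ l] leaves [l - j] factors, and
    [r + 2 * l + 3 <= 7 * l]. *)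
Lemma exponent_inequality U n S W l j T e : 8 * n <= U -> 0 < l -> l <= n -> j <= l ->
  (S * W).+1 <= U ^ 2 ->
  (U - n)`! <= 2 ^ (2 * l + 3 + 4 * T) * (n ^ l * U ^ l * (S * W).+1 ^ (2 * e)) *
    (U - n - (2 * l - j))`! ->
  U ^ (l - j) <= 2 ^ (7 * l + 4 * T) * n ^ l * U ^ (4 * e).
Proof.
move=> nU l_gt0 ln jl SW h; set r := 2 * l - j in h.
have rU : r <= U - n by rewrite /r; lia.
have := leq_trans (leq_exp_fact rU) h; rewrite leq_pmul2r ?fact_gt0 // => {}h.
have U_gt0 : 0 < U by lia.
have hU : U ^ r <= 2 ^ r * (U - n - r) ^ r.
  by rewrite -expnMn; apply: leq_expn; rewrite /r; lia.
have hSW : (S * W).+1 ^ (2 * e) <= U ^ (4 * e).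
  rewrite (_ : 4 * e = 2 * (2 * e)); last by lia.
  by rewrite [U ^ (2 * _)]expnM; apply: leq_expn.
rewrite -(@leq_pmul2r (U ^ l)) ?expn_gt0 ?U_gt0 // -expnD.
rewrite (_ : l - j + l = r); last by rewrite /r; lia.
apply: leq_trans hU _; apply: leq_trans (leq_mul (leqnn _) h) _.
apply: (@leq_trans (2 ^ r * (2 ^ (2 * l + 3 + 4 * T) * (n ^ l * U ^ l * U ^ (4 * e))))).
  by rewrite !leq_mul2l hSW !orbT.
rewrite mulnA -expnD (_ : 2 ^ (7 * l + 4 * T) * _ * _ * _ =
  2 ^ (7 * l + 4 * T) * (n ^ l * U ^ l * U ^ (4 * e))); last by ring.
by rewrite leq_mul2r leq_exp2l // /r; apply/orP; right; lia.
Qed.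

(** Both factors of the memory bound are at most [(2 ^ w) ^ n], so [S <= 2 * n], while
    [2 ^ w <= 2 * U]. *)
Lemma cell_count_bound U n S w : 8 * n <= U -> 0 < n -> w = up_log 2 U ->
  (2 ^ w) ^ S <= 'C(U, n) * 2 ^ n -> (S * 2 ^ w).+1 <= U ^ 2.
Proof.
move=> nU n_gt0 ew hS; have U1 : 1 < U by lia.
have /andP[w1 w2] := up_log_bounds (isT : 1 < 2) U1.
rewrite -ew in w1 w2; have w_gt0 : 0 < w by rewrite ew up_log_gt0.
have W2 : 2 ^ w <= 2 * U by rewrite -(prednK w_gt0) expnS leq_mul2l; lia.
have hC : 'C(U, n) <= U ^ n.
  apply: leq_trans (_ : U ^_ n <= _); first by rewrite -bin_ffact leq_pmulr ?fact_gt0.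
  rewrite ffact_prod -[n in U ^ n]card_ord -prod_nat_const.
  by apply: leq_prod => i _; apply: leq_subr.
have S2 : S <= 2 * n.
  rewrite -(@leq_exp2l (2 ^ w)); last by rewrite -{1}(expn0 2) ltn_exp2l.
  apply: leq_trans hS _; rewrite mul2n -addnn expnD leq_mul //.
    by apply: leq_trans hC _; rewrite leq_exp2r.
  by rewrite leq_exp2r //; lia.
have h1 := leq_mul S2 W2; have h2 := leq_mul nU (leqnn U).
have h3 : 0 < n * U by rewrite muln_gt0; lia.
rewrite -mulnn; lia.
Qed.

End Arithmetic.

(** * Estimates *)

Section Log2.
Variable R : realType.
Implicit Types x y a : R.

Lemma ln2_gt0 : 0 < ln 2 :> R.
Proof. by apply: ln_gt0; rewrite ltr1n. Qed.

Lemma log2M x y : 0 < x -> 0 < y -> log2 (x * y) = log2 x + log2 y.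
Proof. by move=> x0 y0; rewrite /log2 lnM ?posrE // mulrDl. Qed.

Lemma log2X x r : 0 < x -> log2 (x ^+ r) = r%:R * log2 x.
Proof. by move=> x0; rewrite /log2 lnXn // [LHS]mulrnAl -[LHS]mulr_natl. Qed.

Lemma log2_powR x a : log2 (x `^ a) = a * log2 x.
Proof. by rewrite /log2 ln_powR mulrA. Qed.

Lemma log2_2 : log2 2 = 1 :> R.
Proof. by rewrite /log2 divff // gt_eqF // ln2_gt0. Qed.

Lemma ler_log2 x y : 0 < x -> x <= y -> log2 x <= log2 y.
Proof.
move=> x0 xy; rewrite /log2 ler_pM2r ?invr_gt0 ?ln2_gt0 // ler_ln ?posrE //.
exact: lt_le_trans xy.
Qed.

Lemma ltr_log2 x y : 0 < x -> x < y -> log2 x < log2 y.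
Proof.
move=> x0 xy; rewrite /log2 ltr_pM2r ?invr_gt0 ?ln2_gt0 // ltr_ln ?posrE //.
exact: lt_trans xy.
Qed.

Lemma log2_ge0 x : 1 <= x -> 0 <= log2 x.
Proof. by move=> x1; apply: divr_ge0; [exact: ln_ge0|exact: ltW ln2_gt0]. Qed.

Lemma log2_le0 x : x <= 0 -> log2 x = 0.
Proof. by move=> x0; rewrite /log2 ln0 // mul0r. Qed.

Lemma redundancy_le U S w n r : (n <= U)%N -> redundancy R U S w n <= r%:R ->
  ((2 ^ w) ^ S <= 'C(U, n) * 2 ^ r)%N.
Proof.
move=> nU; rewrite /redundancy lerBlDl => h; rewrite leqNgt; apply/negP => hlt.
have C0 : 0 < 'C(U, n)%:R :> R by rewrite ltr0n bin_gt0.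
have := h; rewrite leNgt => /negP[].
have -> : (S * w)%:R = log2 ((2 ^ (w * S))%N%:R : R).
  by rewrite natrX log2X ?ltr0n // log2_2 mulr1 mulnC.
have -> : log2 'C(U, n)%:R + r%:R = log2 (('C(U, n) * 2 ^ r)%N%:R : R).
  by rewrite natrM natrX log2M ?exprn_gt0 ?ltr0n ?bin_gt0 // log2X ?ltr0n // log2_2 mulr1.
apply: ltr_log2; first by rewrite ltr0n muln_gt0 bin_gt0 nU expn_gt0.
by rewrite ltr_nat expnM.
Qed.

(** The redundancy is at least the logarithm of [(U + 1) / U], estimated by [ln (1 + x) <= x] at
    [x = - 1 / (U + 1)] and [ln 2 <= 1]. *)
Lemma redundancy_ge U S w n : (0 < n)%N -> (n <= U)%N ->
  (U.+1 * 'C(U, n) <= U * (2 ^ w) ^ S)%N -> U.+1%:R^-1 <= redundancy R U S w n.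
Proof.
move=> n_gt0 nU h; have U_gt0 : (0 < U)%N by lia.
have C0 : 0 < 'C(U, n)%:R :> R by rewrite ltr0n bin_gt0.
have UR : 0 < U%:R :> R by rewrite ltr0n.
have U1R : 0 < U.+1%:R :> R by rewrite ltr0n.
have h' : log2 U.+1%:R + log2 'C(U, n)%:R <= log2 U%:R + (S * w)%:R :> R.
  have -> : (S * w)%:R = log2 ((2 ^ (w * S))%N%:R : R).
    by rewrite natrX log2X ?ltr0n // log2_2 mulr1 mulnC.
  rewrite -!log2M ?ltr0n ?expn_gt0 ?bin_gt0 // -!natrM; apply: ler_log2.
    by rewrite ltr0n muln_gt0 bin_gt0.
  by rewrite ler_nat expnM.
suff : U.+1%:R^-1 <= log2 U.+1%:R - log2 U%:R :> R.
  by move=> h2; apply: le_trans h2 _; rewrite /redundancy; lra.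
have ln2_le1 : ln 2 <= 1 :> R.
  by rewrite (_ : 2 = 1 + 1 :> R) //; apply: le_ln1Dx; lra.
rewrite /log2 -mulrBl ler_pdivlMr ?ln2_gt0 //.
apply: (@le_trans _ _ U.+1%:R^-1); first by apply: ler_piMr => //; rewrite invr_ge0 ltW.
have H : -1 < - U.+1%:R^-1 :> R by rewrite ltrN2 invf_lt1 // ltr1n.
have := le_ln1Dx H.
have -> : 1 - U.+1%:R^-1 = U%:R / U.+1%:R :> R by rewrite -natr1; field; rewrite natr1 pnatr_eq0.
by rewrite ln_div ?posrE // => h3; rewrite -lerN2 opprB.
Qed.

End Log2.

(** Per key, [(1 - delta) * (1 + alpha) * Ln] faces [(1 + delta / 2) * Ln]. As
    [delta * (2 + alpha) = alpha / 2], the gap exceeds [alpha / 2 * Ln > 8], more than the remaining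
    constants [7 + (1 - delta)]. *)
Lemma log_contradiction (R : realType) (alpha delta l j T e Ln Lu : R) :
  0 < alpha -> 0 < delta -> delta * (2 * (2 + alpha)) = alpha -> 0 < l ->
  j <= delta / 2 * l -> 4 * T <= delta / 2 * l * Ln -> 4 * e <= delta / 2 * l ->
  (1 + alpha) * Ln - 1 <= Lu -> 16 < alpha * Ln ->
  (l - j) * Lu <= 7 * l + 4 * T + l * Ln + 4 * e * Lu -> False.
Proof.
move=> a0 d0 ed l0 hj hT he hLu hLn h.
have Ln0 : 0 < Ln by rewrite -(pmulr_rgt0 _ a0); apply: lt_trans hLn.
have d1 : delta < 1 by nra.
have Lu0 : 0 < Lu by nra.
have h0 : (l - delta * l) * Lu <= (l - j - 4 * e) * Lu by rewrite ler_pM2r //; lra.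
have h1 : l * ((1 - delta) * Lu) <= l * (7 + (1 + delta / 2) * Ln) by lra.
have {}h1 : (1 - delta) * Lu <= 7 + (1 + delta / 2) * Ln by rewrite -(ler_pM2l l0).
have h2 : (1 - delta) * ((1 + alpha) * Ln - 1) <= (1 - delta) * Lu.
  by rewrite ler_pM2l //; lra.
have h3 : delta * (2 * (2 + alpha)) * Ln = alpha * Ln by rewrite ed.
have h4 : 0 < delta * Ln by rewrite mulr_gt0.
lra.
Qed.

(** The number [j = l %/ k + 1] of columns is at most [2 * l / k], yet large enough for
    [2 ^ (5 * k * j)] to reach [2 ^ (2 * l + 3)]. *)
Lemma column_count l k : (1 < k)%N -> (k <= l)%N ->
  [/\ k * (l %/ k).+1 <= 2 * l, (l %/ k).+1 <= l & 2 * l + 3 <= 5 * k * (l %/ k).+1]%N.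
Proof.
move=> k1 kl; have h1 : (k * (l %/ k).+1 <= 2 * l)%N.
  by have := leq_trunc_div l k; rewrite mulnS mulnC; lia.
have h2 : (2 * (l %/ k).+1 <= k * (l %/ k).+1)%N by rewrite leq_mul2r k1 orbT.
have h3 : (l < k * (l %/ k).+1)%N by rewrite mulnC ltn_ceil // ltnW.
split=> //; first by lia.
by rewrite -mulnA; lia.
Qed.

(** A cost below [gamma * J] makes both [T / J] and [e] small against [l], and the block inequality
    then fails after taking logarithms. *)
Lemma scale_bound (R : realType) (alpha delta gamma : R) (n U S k l0 J : nat) :
  let w := up_log 2 U in let q := (2 ^ (5 * k))%N in
  forall D : dict U S (2 ^ w),
  0 < alpha -> 0 < delta -> delta * (2 * (2 + alpha)) = alpha ->
  4 / delta <= k%:R -> (1 < k)%N -> 0 < gamma -> 256 * q%:R ^+ 2 * gamma <= delta ->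
  (0 < n)%N -> (8 * n <= U)%N -> n%:R `^ (1 + alpha) < U.+1%:R ->
  16 < alpha * log2 n%:R ->
  correct_dict n D ->
  ((2 ^ w) ^ S <= 'C(U, n) * 2 ^ l0)%N -> ((2 ^ w) ^ S <= 'C(U, n) * 2 ^ n)%N ->
  (k <= l0)%N -> (0 < J)%N -> (q ^ J * l0 <= n)%N -> (n < q ^ J.+1 * l0)%N ->
  gamma * J%:R <= hard_expected_cost R n D / (4 * n)%:R.
Proof.
move=> w q D a0 d0 ed hk k1 g0 hg n_gt0 nU hU hn Dc hS hSn kl J0 qJ qJ1.
have n2U : (2 * n <= U)%N by apply: leq_trans nU; rewrite leq_mul2r orbT.
have nleU : (n <= U)%N by apply: leq_trans n2U; rewrite leq_pmull.
have U_gt0 : (0 < U)%N := leq_trans n_gt0 nleU.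
pose u0 : 'I_U := Ordinal U_gt0.
have [t tl ht] := @hard_expected_cost_ge R U S _ n D u0 n2U.
rewrite leNgt; apply/negP => hH.
have q_gt0 : (0 < q)%N by rewrite expn_gt0.
have q_gt1 : (1 < q)%N by rewrite /q -{1}(expn0 2) ltn_exp2l // muln_gt0 (ltnW k1).
have p_lt j : (j < n)%N -> (order_of u0 t j < n)%N.
  by move=> jn; have := perm_closed (at_ u0 j) tl; rewrite !inE val_at ?(leq_trans jn).
have p_inj : {in gtn n &, injective (order_of u0 t)}.
  move=> i j; rewrite !inE => i_n jn /ord_inj/perm_inj/at_inj; apply.
    exact: leq_trans i_n nleU.
  exact: leq_trans jn nleU.
have [l [T [e [ll ql hT he hj]]]] :=
  cell_probe_tradeoff u0 Dc n2U p_lt p_inj q_gt0 J0 (leq_trans (ltnW k1) kl) qJ hS.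
set Gam := (\sum_s _)%N in ht hT he.
set H := hard_expected_cost R n D in ht hH.
have l_gt0 : (0 < l)%N := leq_trans (leq_trans (ltnW k1) kl) ll.
have ln : (l <= n)%N by apply: leq_trans ql; rewrite leq_pmull.
set Q := (q ^ J * l0)%N in hT he qJ.
have nqQ : (n <= q * Q)%N by rewrite /Q mulnA -expnS ltnW.
have F0 : 0 < U`!%:R :> R by rewrite ltr0n fact_gt0.
have nR : 0 < n%:R :> R by rewrite ltr0n.
have lR : 0 < l%:R :> R by rewrite ltr0n.
have JR : 1 <= J%:R :> R by rewrite ler1n.
have qR : 0 < q%:R :> R by rewrite ltr0n.
(* Used for [T] and for [e * J]. One factor [q] comes from [n <= q * Q], the other from [q * l]; 256
   is the product of the threshold constant 8, the 4 operations per key and the 8 of [delta / 8]. *)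
have probe_bound (A : nat) : (A * Q * U`! <= 8 * Gam * (q * l))%N ->
    A%:R <= delta / 8 * J%:R * l%:R.
  move=> hA; have h1 : (A * n * U`! <= q * (8 * Gam * (q * l)))%N.
    apply: (@leq_trans (q * (A * Q * U`!))); last by rewrite leq_mul2l hA orbT.
    rewrite (_ : q * _ = A * (q * Q) * U`!)%N; last by ring.
    by rewrite leq_mul2r leq_mul2l nqQ !orbT.
  have {}h1 : A%:R * n%:R * U`!%:R <= 8 * (q%:R ^+ 2 * l%:R) * Gam%:R :> R.
    rewrite -!natrM -natrX -!natrM ler_nat; apply: leq_trans h1 _.
    by apply: eq_leq; ring.
  have h2 : A%:R * n%:R * U`!%:R <= 8 * (q%:R ^+ 2 * l%:R) * (U`!%:R * H).
    by apply: le_trans h1 _; rewrite ler_wpM2l // !mulr_ge0 ?exprn_ge0 ?ler0n.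
  have {}h2 : A%:R * n%:R <= 8 * (q%:R ^+ 2 * l%:R) * H.
    by rewrite -(ler_pM2r F0); apply: le_trans h2 _; lra.
  have h3 : H <= gamma * J%:R * (4 * n%:R).
    by rewrite -ler_pdivrMr ?mulr_gt0 // -natrM ltW.
  have c0 : 0 < 8 * (q%:R ^+ 2 * l%:R) :> R by rewrite !mulr_gt0 ?exprn_gt0.
  have {}h3 : A%:R * n%:R <= 8 * (q%:R ^+ 2 * l%:R) * (gamma * J%:R * (4 * n%:R)).
    by apply: le_trans h2 _; rewrite ler_pM2l.
  have {}h3 : A%:R <= 8 * (q%:R ^+ 2 * l%:R) * (gamma * J%:R * 4).
    by rewrite -(ler_pM2r nR); lra.
  apply: le_trans h3 _.
  have -> : 8 * (q%:R ^+ 2 * l%:R) * (gamma * J%:R * 4) =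
    (256 * q%:R ^+ 2 * gamma) / 8 * (J%:R * l%:R) by field.
  rewrite -[leRHS]mulrA ler_wpM2r ?mulr_ge0 ?ler0n //; lra.
have hT' := probe_bound T hT.
have he' : e%:R <= delta / 8 * l%:R.
  have := probe_bound (e * J)%N he; rewrite natrM => h.
  by rewrite -(@ler_pM2r _ J%:R); lra.
have hJ : J%:R <= log2 n%:R :> R.
  have -> : J%:R = log2 (2 ^+ J) :> R by rewrite log2X // log2_2 mulr1.
  apply: ler_log2; first by rewrite exprn_gt0.
  rewrite -natrX ler_nat; apply: leq_trans qJ; rewrite /Q.
  apply: (@leq_trans (q ^ J)); first exact: leq_expn.
  by rewrite leq_pmulr // (leq_trans (ltnW k1)).
pose j := (l %/ k).+1.
have [hjk jl qj'] := column_count k1 (leq_trans kl ll).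
have qj : (2 ^ (2 * l + 3) <= q ^ j)%N by rewrite /q -expnM leq_exp2l.
have SW : ((S * 2 ^ w).+1 <= U ^ 2)%N by apply: (cell_count_bound nU).
have := exponent_inequality nU l_gt0 ln jl SW (hj j qj).
rewrite -(ler_nat R) => hfin.
have UR : 0 < U%:R :> R by rewrite ltr0n.
have hpos : 0 < (U ^ (l - j))%N%:R :> R by rewrite ltr0n expn_gt0 U_gt0.
have {}hfin := ler_log2 hpos hfin.
have {hfin}: (l%:R - j%:R) * log2 U%:R <=
    7 * l%:R + 4 * T%:R + l%:R * log2 n%:R + 4 * e%:R * log2 U%:R :> R.
  have := hfin; rewrite !natrM !natrX.
  rewrite !log2M ?mulr_gt0 ?exprn_gt0 // !log2X // log2_2 mulr1.
  by rewrite natrB // natrD !natrM.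
apply: (log_contradiction a0 d0 ed lR _ _ _ _ hn).
- have hk' : 4 <= delta * k%:R by rewrite -ler_pdivrMl // mulrC.
  have h : k%:R * j%:R <= 2 * l%:R :> R by rewrite -!natrM ler_nat.
  have h' : 4 * j%:R <= delta * k%:R * j%:R by rewrite ler_wpM2r ?ler0n.
  have : delta * (k%:R * j%:R) <= delta * (2 * l%:R) by rewrite ler_pM2l.
  lra.
- have : delta / 8 * l%:R * J%:R <= delta / 8 * l%:R * log2 n%:R.
    by rewrite ler_wpM2l // mulr_ge0 ?ler0n //; lra.
  lra.
- lra.
- have : log2 (n%:R `^ (1 + alpha)) <= log2 (2 * U%:R).
    apply: ler_log2; first by rewrite powR_gt0.
    apply: ltW; apply: lt_le_trans hU _.
    by rewrite -natrM ler_nat mul2n -addnn -addn1 leq_add2l.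
  by rewrite log2_powR log2M // log2_2; lra.
Qed.

Theorem theorem6 (R : realType) (alpha : R) (halpha : 0 < alpha) :
  exists c : R, 0 < c /\ exists N : nat, forall n : nat, (N <= n)%N ->
  forall U : nat,
    U%:R <= n%:R `^ (1 + alpha) < U.+1%:R ->
  let w := up_log 2 U in
  forall (S : nat) (D : dict U S (2 ^ w)),
    correct_dict n D ->
    redundancy R U S w n <= n%:R ->
    hard_expected_cost R n D / (4 * n)%:R
      >= c * log2 (n%:R / redundancy R U S w n).
Proof.
(* The tolerance of [log_contradiction]: a share [delta / 2] of [l] is allowed to [j], another to
   [4 * e]. *)
pose delta := alpha / (2 * (2 + alpha)).
have d0 : 0 < delta by apply: divr_gt0 => //; lra.
have ed : delta * (2 * (2 + alpha)) = alpha by rewrite divfK // gt_eqF //; lra.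
have d1 : delta < 1 by nra.
have [k k1 hk] : exists2 k, (1 < k)%N & 4 / delta <= k%:R.
  exists (maxn 2 (Num.truncn (4 / delta)).+1); first by rewrite leq_max.
  by apply: le_trans (ltW (truncnS_gt _)) _; rewrite ler_nat leq_maxr.
pose q := (2 ^ (5 * k))%N.
have q_gt0 : (0 < q)%N by rewrite expn_gt0.
have q_gt1 : (1 < q)%N by rewrite /q -{1}(expn0 2) ltn_exp2l // muln_gt0 (ltnW k1).
have q1 : 1 <= q%:R :> R by rewrite ler1n.
have lq0 : 0 <= log2 (q%:R : R) by apply: log2_ge0.
have lk0 : 0 <= log2 ((k + 2)%:R : R) by apply: log2_ge0; rewrite ler1n addn2.
(* [log (n / rho)] will be at most [(2 + alpha) * (J + 1) * log q + C2], which is at most [C4 * J]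
   once [J >= 1]. *)
pose C2 := 1 + (2 + alpha) * log2 ((k + 2)%:R : R).
pose C4 := 2 * ((2 + alpha) * log2 (q%:R : R)) + C2.
have a2 : 0 < 2 + alpha by lra.
have C2_ge1 : 1 <= C2 by rewrite /C2 lerDl mulr_ge0 // ltW.
have lq0' : 0 <= (2 + alpha) * log2 (q%:R : R) by rewrite mulr_ge0 // ltW.
have C4_gt0 : 0 < C4 by rewrite /C4; lra.
pose gamma := delta / (256 * q%:R ^+ 2).
have q2 : 1 <= q%:R ^+ 2 :> R by rewrite exprn_ege1.
have g0 : 0 < gamma by rewrite divr_gt0 // mulr_gt0 //; lra.
have eg : 256 * q%:R ^+ 2 * gamma = delta.
  by rewrite /gamma mulrC divfK // mulf_neq0 // gt_eqF //; lra.
have g1 : gamma <= 4^-1 by rewrite /gamma ler_pdivrMr ?mulr_gt0 //; lra.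
exists (gamma / C4); split; first exact: divr_gt0.
(* Beyond this threshold [alpha * log n >= 17], which yields both the strict bound 16 and
   [8 * n <= U]. *)
exists (Num.truncn (2 `^ (17 / alpha) : R)).+1 => n hN U /andP[hU1 hU2] w S D Dc hn.
have n_gt0 : (0 < n)%N by apply: leq_ltn_trans hN.
have nR : 0 < n%:R :> R by rewrite ltr0n.
have hln : 16 < alpha * log2 (n%:R : R).
  have : 2 `^ (17 / alpha) <= n%:R :> R.
    by apply: le_trans (ltW (truncnS_gt _)) _; rewrite ler_nat.
  move/(ler_log2 (powR_gt0 _ (ltr0n R 2))); rewrite log2_powR log2_2 mulr1.
  by rewrite ler_pdivrMr // mulrC; lra.
have na9 : 9 < n%:R `^ alpha.
  rewrite ltNge; apply/negP => h9.
  have : log2 (n%:R `^ alpha) <= log2 (2 ^+ 4).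
    by apply: ler_log2; [rewrite powR_gt0|apply: le_trans h9 _; rewrite -natrX ler_nat].
  by rewrite log2_powR log2X // log2_2; lra.
have nU : (8 * n <= U)%N.
  have : (9 * n)%N%:R < U.+1%:R :> R.
    apply: le_lt_trans hU2; rewrite powRD ?powRr1 ?ler0n //; last first.
      by apply/implyP => /eqP; lra.
    by rewrite natrM mulrC ler_pM2l // ltW.
  by rewrite ltr_nat ltnS; apply: leq_trans; rewrite leq_mul2r orbT.
have nleU : (n <= U)%N by apply: leq_trans nU; rewrite leq_pmull.
have U_gt0 : (0 < U)%N := leq_trans n_gt0 nleU.
set H := hard_expected_cost R n D; set rho := redundancy R U S w n in hn *.
have H_ge : n%:R <= H by apply: hard_expected_cost_ge_n.
have H4 : 4^-1 <= H / (4 * n)%:R.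
  by rewrite ler_pdivlMr ?ltr0n ?muln_gt0 // natrM; lra.
(* For [rho <= 0] the quotient [n / rho] is not positive, and its logarithm is 0 by convention. *)
have [rho0|rho0] := leP rho 0.
  rewrite log2_le0 ?mulr0; first by apply: le_trans H4; lra.
  by rewrite pmulr_rle0 // invr_le0.
(* The smallest group must dominate the redundancy and, for [column_count], have size at least
   [k]. *)
have [l0 [kl0 rho_l0 l0_ge1 l0_lt1]] : exists l0 : nat, [/\ (k <= l0)%N, rho <= l0%:R,
    1 <= rho -> l0%:R <= (k + 2)%:R * rho & rho < 1 -> l0 = k].
  exists (maxn k (Num.truncn rho).+1); split.
  - exact: leq_maxl.
  - by apply: le_trans (ltW (truncnS_gt _)) _; rewrite ler_nat leq_maxr.
  - move=> rho1; have /andP[ht _] := truncn_itv (ltW rho0).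
    have krho : k%:R <= k%:R * rho by rewrite ler_peMr ?ler0n.
    rewrite (natrD _ k 2) mulrDl; case: leqP => _; last by lra.
    by have k0 := ler0n R k; rewrite -natr1; lra.
  - move=> rho1; rewrite (_ : Num.truncn rho = 0)%N; first by apply/maxn_idPl; apply: ltnW.
    by apply: truncn_def; rewrite (ltW rho0).
have l0_gt0 : (0 < l0)%N := leq_trans (ltnW k1) kl0.
have hS : ((2 ^ w) ^ S <= 'C(U, n) * 2 ^ l0)%N by apply: (@redundancy_le R).
have hSn : ((2 ^ w) ^ S <= 'C(U, n) * 2 ^ n)%N by apply: (@redundancy_le R).
have rho_ge : U.+1%:R^-1 <= rho by apply: redundancy_ge => //; apply: capacityM Dc _ _.
pose J := trunc_log q (n %/ l0).
have nJ : (n < q ^ J.+1 * l0)%N by rewrite -ltn_divLR // trunc_log_ltn.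
have nJR : n%:R <= q%:R ^+ J.+1 * l0%:R :> R by rewrite -natrX -natrM ler_nat ltnW.
have key : log2 (n%:R / rho) <= (2 + alpha) * (J.+1%:R * log2 (q%:R : R)) + C2.
  have lqJ : 0 <= J.+1%:R * log2 (q%:R : R) by rewrite mulr_ge0 ?ler0n.
  have kR : 0 < (k + 2)%:R :> R by rewrite ltr0n addn2.
  have qJ0 : 0 < q%:R ^+ J.+1 :> R by rewrite exprn_gt0 // ltr0n.
  have [rho1|rho1] := leP 1 rho.
    have hl0 := l0_ge1 rho1.
    have : log2 (n%:R / rho) <= log2 ((k + 2)%:R * q%:R ^+ J.+1 : R).
      apply: ler_log2; first exact: divr_gt0.
      rewrite ler_pdivrMr //; apply: le_trans nJR _.
      by rewrite -mulrA mulrCA ler_pM2l.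
    rewrite log2M // log2X ?ltr0n // /C2 => h; apply: le_trans h _.
    by have := mulr_ge0 (ltW halpha) lk0; have := mulr_ge0 (ltW halpha) lqJ; lra.
  (* Redundancy below 1 is still at least [1 / (U + 1)], so [log (n / rho)] is at most about
     [(2 + alpha) * log n]. As [l0] is the constant [k], the number of scales is of the order of
     [log n] too. *)
  have el0 := l0_lt1 rho1.
  have : log2 (n%:R / rho) <= log2 (2 * (n%:R * n%:R `^ (1 + alpha))).
    apply: ler_log2; first exact: divr_gt0.
    have hr : rho^-1 <= U.+1%:R by rewrite -[leRHS]invrK lef_pV2 ?posrE ?invr_gt0 ?ltr0n.
    rewrite mulrCA ler_pM2l //; apply: le_trans hr _.
    have : (U.+1)%:R <= 2 * U%:R :> R by rewrite -natrM ler_nat mul2n -addnn -addn1 leq_add2l.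
    by move/le_trans; apply; rewrite ler_pM2l.
  rewrite log2M ?mulr_gt0 ?powR_gt0 // log2_2 log2M ?powR_gt0 // log2_powR => h.
  apply: le_trans h _.
  have : log2 (n%:R : R) <= log2 (q%:R ^+ J.+1 * (k + 2)%:R).
    apply: ler_log2 => //; apply: le_trans nJR _.
    by rewrite ler_pM2l // el0 ler_nat leq_addr.
  rewrite log2M // log2X ?ltr0n // => h.
  have := ler_wpM2l (ltW a2) h; rewrite /C2; lra.
(* When [J = 0], [log (n / rho)] is at most [C4], and one probe per initial insertion, a quarter of
   the operations, suffices. *)
have [J0|J0] := posnP J.
  rewrite J0 mul1r in key; apply: le_trans H4.
  apply: le_trans g1; rewrite mulrAC ler_pdivrMr // ler_pM2l // /C4; lra.
apply: (@le_trans _ _ (gamma * J%:R)).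
  rewrite -mulrA ler_pM2l // mulrC ler_pdivrMr //; apply: le_trans key _.
  have J1 : 1 <= J%:R :> R by rewrite ler1n.
  rewrite -natr1 /C4.
  have := ler_wpM2l lq0' J1; have := ler_wpM2l (le_trans ler01 C2_ge1) J1.
  by rewrite !mulr1; lra.
have qJ : (q ^ J * l0 <= n)%N.
  rewrite -leq_divRL // trunc_logP // lt0n; apply: contraTneq J0 => e0.
  by rewrite /J e0 trunc_log0.
by apply: (scale_bound halpha d0 ed hk k1 g0 _ n_gt0 nU hU2 hln Dc hS hSn kl0 J0 qJ nJ); rewrite eg.
Qed.
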